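(* Let $\sigma$ be a cone in a finite-dimensional real vector space $V$ and let $\tau$ be a face of $\sigma$. Then there is an inequality, coefficient by coefficient, of polynomials with non-negative coefficients $$ip(\sigma)\ge ip(\tau)\cdot ip(\mathrm{Star}(\tau)).$$
   Context: Fans. Cones are closed convex polyhedral cones with vertex at the origin $o$, with $o$ itself a face. A fan $\Phi$ in $V$ is a finite collection of such cones such that any two intersect along a common face, and every face of a cone in $\Phi$ is in $\Phi$; the origin is the unique minimal cone. Write $\tau\le\sigma$ if $\tau$ is a face of $\sigma$. $\Phi$ is viewed as a topological space whose open subsets are the subfans. $[\sigma]$ is the fan consisting of $\sigma$ and all its faces, $\partial\sigma$ the subfan of proper faces, $\mathrm{Star}(\sigma)=\{\tau\in\Phi:\tau\ge\sigma\}$. A sheaf $F$ on $\Phi$ is the same as a system of stalks $F_\sigma=\Gamma([\sigma];F)$ with compatible restriction maps $F_\sigma\to F_\tau$ for $\tau\le\sigma$. A sheaf is flabby if sections over any open subset extend to $\Phi$. Modules. $A=\mathrm{Sym}(V^* )$, graded with $V^*$ in degree 2. $\mathcal{A}_\Phi$ is the sheaf of graded algebras with $\mathcal{A}_{\Phi,\sigma}=\mathrm{Sym}(\mathrm{Span}(\sigma)^* )$ and restriction of functions as structure maps. All modules are graded and (locally) finitely generated. $\mathfrak{M}(\mathcal{A}_\Phi)$ is the category of flabby $\mathcal{A}_\Phi$-modules $\mathcal{M}$ that are locally free (each $\mathcal{M}_\sigma$ is a free graded $\mathcal{A}_{\Phi,\sigma}$-module), with morphisms of degree zero. $\overline{M}=M/A^+M$,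 with $A^+\subset A$ the ideal of elements of positive degree. Minimal sheaves. $\mathcal{M}\in\mathfrak{M}(\mathcal{A}_\Phi)$ is a minimal sheaf based at $\rho\in\Phi$ if (1) $\mathcal{M}_\rho\ne0$ and $\mathcal{M}_\xi\neq0$ only if $\xi\in\mathrm{Star}(\rho)$; (2) for every $\xi\in\mathrm{Star}(\rho)$, $\xi\neq\rho$, the canonical map $\overline{\mathcal{M}_\xi}\to\overline{\Gamma(\partial\xi;\mathcal{M})}$ is an isomorphism. $\mathcal{L}^\rho_\Phi$ is the (unique up to isomorphism) minimal sheaf based at $\rho$ with stalk at $\rho$ isomorphic to $\mathcal{A}_{\Phi,\rho}$; $\mathcal{L}_\Phi=\mathcal{L}_\Phi^{o}$. Define graded vector spaces $IP(\sigma)=\overline{\mathcal{L}_{[\sigma],\sigma}}$, $IP(\tau)=\overline{\mathcal{L}_{[\tau],\tau}}$, and $IP(\mathrm{Star}(\tau))=\overline{\mathcal{L}^\tau_{[\sigma],\sigma}}$ (stalk at $\sigma$ of the minimal sheaf on $[\sigma]$ based at $\tau$); $ip(\sigma)$, $ip(\tau)$, $ip(\mathrm{Star}(\tau))$ are the corresponding Poincaré polynomials. *)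

(* Defs.v *)
From HB Require Import structures.
From mathcomp Require Import all_boot all_order all_algebra.
From mathcomp Require Export mpoly.
From mathcomp Require Import boolp classical_sets cardinality reals.

Set Implicit Arguments.
Unset Strict Implicit.
Unset Printing Implicit Defensive.

Import Order.TTheory GRing.Theory Num.Theory.
Local Open Scope classical_set_scope.
Local Open Scope ring_scope.

(** * Cones and fans *)

Section Cones.
Context {R : realType} {V : vectType R}.

Definition conic_hull (s : seq V) : set V :=
  [set x | exists2 a : 'I_(size s) -> R,
             forall i, 0 <= a i & x = \sum_(i < size s) a i *: s`_i].

(* [l = 0] is allowed, so that [c] is a face of itself. *)
Definition supported_face (t c : set V) : Prop :=
  exists2 l : {scalar V},
    forall x, c x -> 0 <= l x & t = [set x | c x /\ l x = 0].

(* Finitely generated cones are closed. *)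
Record cone := Cone {
  cone_set :> set V;
  cone_polyhedral : exists s : seq V, cone_set = conic_hull s;
  cone_pointed : supported_face [set 0] cone_set }.

Definition face (t c : cone) : Prop := supported_face t c.

Lemma cone_eq (c d : cone) : cone_set c = cone_set d -> c = d.
Proof.
case: c d => [c p q] [d p' q'] /= e; subst d.
by congr Cone; apply: Prop_irrelevance.
Qed.

Lemma supported_face_refl (c : set V) : supported_face c c.
Proof.
exists (\0%R : {scalar V}) => //.
by apply/seteqP; split => [x cx|x []].
Qed.

Fact origin_polyhedral : exists s : seq V, [set 0] = conic_hull s.
Proof.
exists [::]; apply/seteqP; split => [x /= ->|x [a _ ->]]; last by rewrite big_ord0.
by exists (fun _ => 0) => //; rewrite big_ord0.
Qed.

Definition origin : cone := Cone origin_polyhedral (supported_face_refl _).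

Lemma conic_hull_gen (s : seq V) i : (i < size s)%N -> conic_hull s s`_i.
Proof.
move=> lti; exists (fun j => (j == Ordinal lti)%:R) => [j|]; first exact: ler0n.
rewrite (bigD1 (Ordinal lti)) //= eqxx scale1r big1 ?addr0 // => j /negPf ->.
by rewrite scale0r.
Qed.

Lemma faceE (s : seq V) (l : {scalar V}) :
  (forall x, conic_hull s x -> 0 <= l x) ->
  [set x | conic_hull s x /\ l x = 0] = conic_hull [seq x <- s | l x == 0].
Proof.
move=> l0; apply/seteqP; split => x.
- move=> [[a a0 ->]]; rewrite linear_sum /= => /eqP.
  rewrite psumr_eq0 => [|i _]; last first.
    by rewrite linearZ mulr_ge0 // l0 //; apply: conic_hull_gen.
  move=> /allP h; elim: s a a0 h {l0} => [|y s IH] a a0 h.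
    by exists (fun _ => 0) => //; rewrite !big_ord0.
  have [b b0 eb] : conic_hull [seq x <- s | l x == 0]
      (\sum_(i < size s) a (lift ord0 i) *: s`_i).
    apply: IH => [i|i _]; first exact: a0.
    by have := h (lift ord0 i) (mem_index_enum _).
  have := h ord0 (mem_index_enum _).
  rewrite big_ord_recl /= linearZ mulf_eq0 eb; case: ifP => [ly _|_].
    exists (fun i => if unlift ord0 i is Some j then b j else a ord0) => [i|].
      by case: unlift.
    rewrite big_ord_recl unlift_none; congr (_ + _).
    by apply: eq_bigr => i _; rewrite liftK.
  by rewrite orbF => /eqP ->; exists b => //; rewrite scale0r add0r.
- move=> [a a0 ->]; split; last first.
    rewrite linear_sum big1 // => i _; rewrite linearZ.
    have := mem_nth 0 (ltn_ord i); rewrite mem_filter => /andP[/eqP ->].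
    by rewrite /= mulr0.
  elim: s a a0 {l0} => [|y s IH] /=; first by move=> a a0; exists a.
  have tl (b : 'I_(size s) -> R) (r : R) : (forall i, 0 <= b i) -> 0 <= r ->
    conic_hull (y :: s) (r *: y + \sum_(i < size s) b i *: s`_i).
    move=> b0 r0.
    exists (fun i => if unlift ord0 i is Some j then b j else r) => [i|].
      by case: unlift.
    rewrite /= big_ord_recl unlift_none; congr (_ + _).
    by apply: eq_bigr => i _; rewrite liftK.
  case: ifP => _ a a0.
    rewrite big_ord_recl /=.
    have [i|b b0 ->] := IH (fun i => a (lift ord0 i)); first exact: a0.
    exact: tl.
  have [b b0 ->] := IH a a0.
  by have := tl b 0 b0 (lexx _); rewrite scale0r add0r.
Qed.

Lemma supported_face_cone (c : cone) (t : set V) :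
  supported_face t c -> exists d : cone, cone_set d = t.
Proof.
move=> [l l0 et].
have pt : exists s, t = conic_hull s.
  have [s es] := cone_polyhedral c.
  exists [seq x <- s | l x == 0]; rewrite et es; apply: faceE.
  by rewrite -es.
have qt : supported_face [set 0] t.
  have [k k0 e0] := cone_pointed c.
  have /= [c0 _] : [set x | cone_set c x /\ k x = 0] 0 by rewrite -e0.
  exists k => [x|]; first by rewrite et => -[/k0].
  apply/seteqP; split => x; first by move=> ->; rewrite et /= !linear0.
  by rewrite et => -[[cx _] kx]; rewrite e0.
by exists (Cone pt qt).
Qed.

Lemma face_trans (u t c : cone) : face u t -> face t c -> face u c.
Proof.
move=> [k k0 eu] [l l0 et].
have [s es] := cone_polyhedral c.
have k0' i : (i < size s)%N -> l s`_i = 0 -> 0 <= k s`_i.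
  by move=> /conic_hull_gen; rewrite -es => ci li; apply: k0; rewrite et.
have li0 i : (i < size s)%N -> 0 <= l s`_i.
  by move=> /conic_hull_gen; rewrite -es => /l0.
pose N : R := \sum_(i < size s) `|k s`_i| / l s`_i.
have N0 : 0 <= N by apply: sumr_ge0 => i _; rewrite divr_ge0 // li0.
have kN i : (i < size s)%N -> 0 <= N * l s`_i + k s`_i.
  move=> lti; have [l_i|l_i] := eqVneq (l s`_i) 0.
    by rewrite l_i mulr0 add0r k0'.
  have lp : 0 < l s`_i by rewrite lt_def l_i li0.
  rewrite -lerBlDr sub0r; apply: (@le_trans _ _ `|k s`_i|); first by rewrite -normrN ler_norm.
  rewrite -ler_pdivrMr // /N (bigD1 (Ordinal lti)) //= lerDl.
  by apply: sumr_ge0 => j _; rewrite divr_ge0 // li0.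
have lin : scalar (fun x => N * l x + k x : R).
  move=> a x y; rewrite !linearP /= !mulrDr addrACA; congr (_ + _).
  by rewrite mulrCA.
have mpos x : cone_set c x -> 0 <= N * l x + k x.
  rewrite es => -[a a0 xE].
  have -> : N * l x + k x = \sum_(i < size s) a i * (N * l s`_i + k s`_i).
    rewrite xE !linear_sum mulr_sumr -big_split; apply: eq_bigr => i _ /=.
    by rewrite !linearZ /= mulrDr mulrCA.
  apply: sumr_ge0 => i _; apply: mulr_ge0 => //.
  exact: kN.
(* one more copy of [l] makes the sum vanish only where [l] does *)
have lin' : scalar (fun x => l x + (N * l x + k x) : R).
  move=> a x y; rewrite (lin a x y) linearP /=.
  by rewrite addrACA -mulrDr.
pose mm' := GRing.isLinear.Build R V R _ (fun x => l x + (N * l x + k x)) lin'.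
pose m' : {scalar V} := HB.pack (fun x => l x + (N * l x + k x)) mm'.
exists m' => [x cx|]; first by rewrite /= addr_ge0 ?mpos ?l0.
rewrite eu et; apply/seteqP; split => x /=.
  by move=> [[cx lx] kx]; rewrite lx kx mulr0 !addr0.
move=> [cx /eqP]; rewrite paddr_eq0 ?mpos ?l0 // => /andP[/eqP lx].
by rewrite lx mulr0 add0r => /eqP.
Qed.

Lemma faces_meet (c t u : cone) : face t c -> face u c ->
  exists m : cone, [/\ cone_set m = t `&` u, face m t & face m u].
Proof.
move=> [k k0 et] [l l0 eu].
have f1 : supported_face (t `&` u) t.
  exists l => [x|]; first by rewrite et => -[/l0].
  apply/seteqP; split => x /=; first by rewrite eu => -[tx []].
  by move=> [tx lx]; split=> //; move: tx; rewrite et eu => -[].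
have f2 : supported_face (t `&` u) u.
  exists k => [x|]; first by rewrite eu => -[/k0].
  apply/seteqP; split => x /=; first by rewrite et => -[[_ kx] ux].
  by move=> [ux kx]; split=> //; move: ux; rewrite et eu => -[].
have [m em] := supported_face_cone f1.
by exists m; rewrite /face em.
Qed.

Lemma finite_faces (c : cone) : finite_set [set t | face t c].
Proof.
have [s es] := cone_polyhedral c.
pose f (t : cone) : {set 'I_(size s)} := finset (fun i : 'I_(size s) => `[< cone_set t s`_i >]).
have finj : {in [set t | face t c] &, injective f}.
  have inc (t u : cone) : face t c -> face u c -> f t = f u -> t `<=` u.
    move=> [k k0 et] [l l0 eu] efs x; rewrite et => -[cx kx].
    rewrite eu; split=> //; move: cx kx; rewrite es => -[a a0 ->].
    rewrite !linear_sum /= => /eqP; rewrite psumr_eq0 => [|i _]; last first.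
      rewrite linearZ mulr_ge0 // k0 // es; exact: conic_hull_gen.
    move=> /allP h; rewrite big1 // => i _.
    have := h i (mem_index_enum _); rewrite !linearZ /= mulf_eq0.
    case/orP => /eqP e; first by rewrite e mul0r.
    have : i \in f t.
      rewrite inE; apply/asboolP; rewrite et; split=> //.
      by rewrite es; apply: conic_hull_gen.
    by rewrite efs inE => /asboolP; rewrite eu => -[_ ->]; rewrite /= mulr0.
  move=> t u /set_mem tc /set_mem uc e; apply/cone_eq/seteqP.
  by split; apply: inc.
rewrite -(eq_finite_set (inj_card_eq finj)).
exact: finite_finset.
Qed.

Record fan := Fan {
  fan_cones :> set cone;
  fan_finite : finite_set fan_cones;
  fan_face : forall c t : cone, fan_cones c -> face t c -> fan_cones t;
  fan_meet : forall c d : cone, fan_cones c -> fan_cones d ->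
    exists m : cone, [/\ cone_set m = c `&` d, face m c & face m d] }.

Definition cone_fan (c : cone) : fan :=
  @Fan [set t | face t c] (finite_faces c)
       (fun t u tc ut => face_trans ut tc) (@faces_meet c).

(* The open subsets of a fan. *)
Definition subfan (F : fan) (U : set cone) : Prop :=
  U `<=` F /\ forall c t : cone, U c -> face t c -> U t.

Definition boundary (c : cone) : set cone := [set t | face t c /\ t <> c].

Definition star (F : fan) (c : cone) : set cone := [set d | fan_cones F d /\ face c d].

Definition cone_span (c : cone) : {vspace V} :=
  <<sval (cid (cone_polyhedral c))>>%VS.

Lemma cone_spanP (c : cone) (W : {vspace V}) :
  (cone_span c <= W)%VS <-> forall x, cone_set c x -> x \in W.
Proof.
rewrite /cone_span; case: cid => s /= es; split.
  move=> sW x; rewrite es => -[a _ ->].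
  apply: memv_suml => i _; apply/memvZ/(subvP sW)/memv_span.
  exact: mem_nth.
move=> cW; apply/span_subvP => x /(nthP 0)[i lti <-]; apply: cW.
by rewrite es; apply: conic_hull_gen.
Qed.

End Cones.

Arguments cone {R} V.
Arguments fan {R} V.

(** * Graded modules over polynomial rings *)

Section GradedModules.
Context {R : realType} {n : nat}.

(* The variables are placed in degree 2, so a form of polynomial degree [k]
   shifts the grading by [2 * k]. *)
Record graded_module := GradedModule {
  gm_sort :> lmodType {mpoly R[n]};
  gm_deg : int -> set gm_sort;
  gm_deg0 : forall d, gm_deg d 0;
  gm_degB : forall d x y, gm_deg d x -> gm_deg d y -> gm_deg d (x - y);
  gm_degZ : forall d (k : nat) (a : {mpoly R[n]}) x, a \is k.-homog ->
    gm_deg d x -> gm_deg (d + (2 * k)%:Z) (a *: x);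
  gm_decomp : forall x, exists s : seq int, exists f : int -> gm_sort,
    [/\ uniq s, forall d, gm_deg d (f d) & x = \sum_(d <- s) f d];
  gm_indep : forall (s : seq int) (f : int -> gm_sort), uniq s ->
    (forall d, gm_deg d (f d)) -> \sum_(d <- s) f d = 0 ->
    forall d, d \in s -> f d = 0 }.

Definition graded_iso (M N : graded_module) : Prop :=
  exists f : {linear M -> N},
    bijective f /\ forall d x, gm_deg d x -> gm_deg d (f x).

(* A finitely generated free graded module has a finite homogeneous basis. *)
Definition graded_free (M : graded_module) : Prop :=
  exists k : nat, exists e : 'I_k -> M, exists d : 'I_k -> int,
    (forall i, gm_deg (d i) (e i)) /\
    forall x : M, exists! a : {ffun 'I_k -> {mpoly R[n]}},
      x = \sum_(i < k) a i *: e i.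

(* The polynomial ring as a graded module over itself. *)
Definition poly_deg (d : int) : set {mpoly R[n]}^o :=
  [set p | p = 0 \/ exists2 k : nat, d = (2 * k)%:Z & p \is k.-homog].

Fact poly_deg0 d : poly_deg d 0.
Proof. by left. Qed.

Fact poly_degB d x y : poly_deg d x -> poly_deg d y -> poly_deg d (x - y).
Proof.
move=> [->|[k dk xk]] [->|[l dl yl]].
- by left; rewrite subr0.
- by right; exists l => //; rewrite sub0r rpredN.
- by right; exists k => //; rewrite subr0.
- right; exists k => //; apply: rpredB => //.
  suff -> : k = l by [].
  by apply/eqP; rewrite -(@eqn_pmul2l 2) // -eqz_nat -dk -dl.
Qed.

Fact poly_degZ d (k : nat) (a : {mpoly R[n]}) x : a \is k.-homog ->
  poly_deg d x -> poly_deg (d + (2 * k)%:Z) (a *: x).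
Proof.
move=> ak [->|[l -> xl]]; first by left; rewrite scaler0.
right; exists (k + l)%N; last exact: dhomogM.
by rewrite -PoszD -mulnDr addnC.
Qed.

Fact poly_decomp (x : {mpoly R[n]}^o) : exists s : seq int, exists f : int -> {mpoly R[n]}^o,
  [/\ uniq s, forall d, poly_deg d (f d) & x = \sum_(d <- s) f d].
Proof.
exists [seq (2 * k)%:Z | k <- iota 0 (msize x)].
exists (fun d => if ~~ odd `|d| && (0 <= d) then pihomog mdeg `|d|./2 x else 0).
split.
- rewrite map_inj_uniq ?iota_uniq // => k l [/eqP].
  by rewrite eqn_pmul2l // => /eqP.
- move=> d; case: ifP => [/andP[od d0]|_]; last by left.
  right; exists `|d|./2; last exact: pihomogP.
  by rewrite mul2n halfK (negbTE od) subn0 gez0_abs.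
- rewrite big_map /= {1}(pihomog_partitionE (leqnn (msize x))).
  rewrite -[iota 0 _](_ : index_iota 0 (msize x) = _); last first.
    by rewrite /index_iota subn0.
  rewrite big_mkord; apply: eq_bigr => i _.
  by rewrite /= mul2n odd_double doubleK.
Qed.

Fact poly_indep (s : seq int) (f : int -> {mpoly R[n]}^o) : uniq s ->
  (forall d, poly_deg d (f d)) -> \sum_(d <- s) f d = 0 ->
  forall d, d \in s -> f d = 0.
Proof.
move=> us fd s0 d ds; case: (fd d) => // -[k dk fk].
have : pihomog mdeg k (\sum_(d <- s) f d) = 0 by rewrite s0 linear0.
rewrite linear_sum (bigD1_seq d) //= pihomog_dE // big1 ?addr0 // => e ed.
case: (fd e) => [->|[l el fl]]; first by rewrite linear0.
apply: pihomog_ne0 fl; apply: contra ed => /eqP lk.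
by rewrite el dk lk.
Qed.

Definition poly_module : graded_module :=
  GradedModule poly_deg0 poly_degB poly_degZ poly_decomp poly_indep.

End GradedModules.

Arguments graded_module R n : clear implicits.
Arguments poly_module R n : clear implicits.

(** * Sheaves on fans *)

Section Sheaves.
Context {R : realType} {V : vectType R}.

(* [Sym (W^* )] is the polynomial ring in the coordinate functions of [W]
   relative to [vbasis W]. *)
Local Notation Sym W := {mpoly R[\dim W]}.

(* Restriction of polynomial functions from [W] to a subspace [U]: each
   coordinate function of [W] becomes a linear form in those of [U]. *)
Definition sym_res (W U : {vspace V}) (a : Sym W) : Sym U :=
  a \mPo [tuple \sum_(j < \dim U)
                  coord (vbasis W) i (vbasis U)`_j *: 'X_j | i < \dim W].

(* A sheaf of graded modules over [c |-> Sym (Span c)^*], given by its stalks.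
   The components at cones outside the fan carry no information. *)
Record sheaf (F : fan V) := Sheaf {
  stalk :> forall c : cone V, graded_module R (\dim (cone_span c));
  res : forall c t : cone V, stalk c -> stalk t;
  res_add : forall (c t : cone V) (x y : stalk c), fan_cones F c -> face t c ->
    res t (x + y) = res t x + res t y;
  res_scale : forall (c t : cone V) a (x : stalk c), fan_cones F c -> face t c ->
    res t (a *: x) = sym_res (cone_span t) a *: res t x;
  res_deg : forall (c t : cone V) d (x : stalk c), fan_cones F c -> face t c ->
    gm_deg d x -> gm_deg d (res t x);
  res_id : forall (c : cone V) (x : stalk c), fan_cones F c -> res c x = x;
  res_comp : forall (c t u : cone V) (x : stalk c), fan_cones F c -> face t c -> face u t ->
    res u (res t x) = res u x }.

Section Sheaf.
Context {F : fan V} (M : sheaf F).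

(* Elements of [Gamma(U; M)], again ignoring the components outside [U]. *)
Definition is_section (U : set (cone V)) (s : forall c, M c) : Prop :=
  forall c t : cone V, U c -> U t -> face t c -> res t (s c) = s t.

Definition flabby : Prop :=
  forall (U : set (cone V)) (s : forall c, M c), subfan F U -> is_section U s ->
    exists2 s' : forall c, M c, is_section F s' & forall c, U c -> s' c = s c.

Definition locally_free : Prop := forall c : cone V, fan_cones F c -> graded_free (M c).

(* The ideal [A^+] of [A = Sym (V^* )]. *)
Definition sym_plus (a : Sym (fullv : {vspace V})) : Prop := a@_0%MM = 0.

(* The submodule [A^+ M_c] of [M_c]; [A] acts through restriction to the span
   of [c]. *)
Definition stalk_plus (c : cone V) (x : M c) : Prop :=
  exists k : nat, exists a : 'I_k -> Sym (fullv : {vspace V}),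
  exists y : 'I_k -> M c,
    (forall i, sym_plus (a i)) /\
    x = \sum_(i < k) sym_res (cone_span c) (a i) *: y i.

(* The submodule [A^+ Gamma(U; M)] of [Gamma(U; M)]. *)
Definition section_plus (U : set (cone V)) (s : forall c, M c) : Prop :=
  exists k : nat, exists a : 'I_k -> Sym (fullv : {vspace V}),
  exists y : 'I_k -> forall c, M c,
    [/\ forall i, sym_plus (a i), forall i, is_section U (y i) &
        forall c, U c -> s c = \sum_(i < k) sym_res (cone_span c) (a i) *: y i c].

(* The map [M_c / A^+ M_c -> Gamma(bd c; M) / A^+ Gamma(bd c; M)] is
   injective and surjective. *)
Definition bar_boundary_iso (c : cone V) : Prop :=
  (forall x : M c, section_plus (boundary c) (fun t => res t x) -> stalk_plus x) /\
  (forall s : forall t, M t, is_section (boundary c) s ->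
     exists x : M c, section_plus (boundary c) (fun t => s t - res t x)).

Definition minimal_sheaf (r : cone V) : Prop :=
  [/\ fan_cones F r, flabby, locally_free,
      (exists x : M r, x <> 0) /\
      (forall c : cone V, fan_cones F c -> (exists x : M c, x <> 0) -> star F r c) &
      forall c : cone V, star F r c -> c <> r -> bar_boundary_iso c].

(* [M] is (isomorphic to) the minimal sheaf [L^r] on [F]. *)
Definition is_minimal_sheaf_at (r : cone V) : Prop :=
  minimal_sheaf r /\ graded_iso (poly_module R (\dim (cone_span r))) (M r).

(* The degree [d] part of [M_c / A^+ M_c] has dimension [k] over [R]: the
   classes of the [b i] form a basis. *)
Definition bar_dim (c : cone V) (d : int) (k : nat) : Prop :=
  exists b : 'I_k -> M c,
    (forall i, gm_deg d (b i)) /\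
    forall x : M c, gm_deg d x ->
      exists! r : {ffun 'I_k -> R},
        stalk_plus (x - \sum_(i < k) (r i)%:MP *: b i).

(* [p] is the Poincare polynomial of [M_c / A^+ M_c]. *)
Definition bar_poincare (c : cone V) (p : {poly nat}) : Prop :=
  forall d : int, bar_dim c d (if d is Posz m then (p`_m)%R else 0%N).

End Sheaf.

End Sheaves.

(* Main.v *)
(** Let [M] be the sheaf [L_sigma] on the star of [tau]; it is still flabby and
    locally free there. Let [K] be the direct sum of shifted copies of [L^tau],
    one for each element of a homogeneous basis of the stalk of [L_sigma] at
    [tau], so that [K] and [M] have isomorphic stalks at [tau]. Since locally
    free sheaves map to flabby ones, this isomorphism and its inverse extend to
    morphisms [i : K -> M] and [p : M -> K]. The composite of [i] and [p] is
    invertible at [tau], hence everywhere, because [K] is minimal. So [K] is a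
    retract of [M], and its stalk at [sigma] has no more generators in each
    degree. Applied to [L_tau] and the restriction of [L_sigma] to the faces of
    [tau], the same argument shows that [ip(tau)] is at most the Poincare
    polynomial of the stalk of [L_sigma] at [tau], which is all that is needed. *)

From HB Require Import structures.
Require Import Defs.
From mathcomp Require Import all_boot all_order all_algebra.
From mathcomp Require Import boolp classical_sets reals.

Set Implicit Arguments.
Unset Strict Implicit.
Unset Printing Implicit Defensive.

Import Order.TTheory GRing.Theory Num.Theory.

(** * Graded modules *)

Section HomogeneousComponents.
Local Open Scope ring_scope.
Context {R : realType} {n : nat} {M : graded_module R n}.
Implicit Types (x y : M) (d : int) (s : seq int).

Lemma gm_degN d x : gm_deg d x -> gm_deg d (- x).
Proof. by rewrite -sub0r; apply: gm_degB; apply: gm_deg0. Qed.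

Lemma gm_degD d x y : gm_deg d x -> gm_deg d y -> gm_deg d (x + y).
Proof. by move=> dx /gm_degN; rewrite -{2}[y]opprK; apply: gm_degB. Qed.

Lemma gm_deg_sum d (I : Type) (r : seq I) (P : pred I) (F : I -> M) :
  (forall i, P i -> gm_deg d (F i)) -> gm_deg d (\sum_(i <- r | P i) F i).
Proof.
move=> h; elim/big_ind: _ => //; first exact: gm_deg0.
by move=> x y; apply: gm_degD.
Qed.

Lemma eq_sum_supp s u (f : int -> M) : uniq s -> uniq u -> {subset s <= u} ->
  (forall d, d \notin s -> f d = 0) -> \sum_(d <- u) f d = \sum_(d <- s) f d.
Proof.
move=> us uu su f0; rewrite (bigID (mem s)) /= [X in _ + X]big1 // addr0.
rewrite -big_filter; apply/perm_big/uniq_perm => //; first exact: filter_uniq.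
by move=> d; rewrite mem_filter andb_idr //; apply: su.
Qed.

(** The components form a function on all of [int], zero off a finite list; two decompositions can
    then be subtracted degree by degree, which yields uniqueness from [gm_indep]. *)
Definition homog_decomp x (f : int -> M) : Prop :=
  (forall d, gm_deg d (f d)) /\ exists s,
    [/\ uniq s, forall d, d \notin s -> f d = 0 & x = \sum_(d <- s) f d].

Lemma homog_decomp_exists x : exists f, homog_decomp x f.
Proof.
have [s [f [us fd xE]]] := gm_decomp x.
exists (fun d => if d \in s then f d else 0); split.
  by move=> d; case: ifP => // _; apply: gm_deg0.
exists s; split=> // [d /negbTE -> //|]; rewrite xE big_seq [RHS]big_seq.
by apply: eq_bigr => d ->.
Qed.

Lemma homog_decompB x y f g :
  homog_decomp x f -> homog_decomp y g -> homog_decomp (x - y) (fun d => f d - g d).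
Proof.
move=> [fd [s [us f0 ->]]] [gd [t [ut g0 ->]]]; split.
  by move=> d; apply: gm_degB.
exists (undup (s ++ t)); split; first exact: undup_uniq.
  move=> d; rewrite mem_undup mem_cat negb_or => /andP[ds dt].
  by rewrite f0 // g0 // subrr.
rewrite sumrB; congr (_ - _); apply/esym/eq_sum_supp; rewrite ?undup_uniq //.
  by move=> d ds; rewrite mem_undup mem_cat ds.
by move=> d ds; rewrite mem_undup mem_cat ds orbT.
Qed.

Lemma homog_decomp0 f : homog_decomp 0 f -> forall d, f d = 0.
Proof.
move=> [fd [s [us f0 /esym sE]]] d; have [ds|/f0 //] := boolP (d \in s).
exact: gm_indep sE _ ds.
Qed.

Definition hproj d x : M := sval (cid (homog_decomp_exists x)) d.

Lemma hproj_decomp x : homog_decomp x (hproj ^~ x).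
Proof. by rewrite /hproj; case: cid. Qed.

Lemma hprojP x f d : homog_decomp x f -> hproj d x = f d.
Proof.
move=> xf; have := homog_decompB (hproj_decomp x) xf.
by rewrite subrr => /homog_decomp0/(_ d)/subr0_eq.
Qed.

Lemma hproj_deg d x : gm_deg d (hproj d x).
Proof. exact: (hproj_decomp x).1. Qed.

Lemma hprojB d : {morph hproj d : x y / x - y}.
Proof.
move=> x y; apply: (hprojP (f := fun d => hproj d x - hproj d y)).
by apply: homog_decompB; apply: hproj_decomp.
Qed.

HB.instance Definition _ d :=
  GRing.isZmodMorphism.Build M M (hproj d) (hprojB d).

Lemma hproj_id d x : gm_deg d x -> hproj d x = x.
Proof.
move=> dx; have xf : homog_decomp x (fun e => if e == d then x else 0).
  split=> [e|]; first by case: eqP => [->|_] //; apply: gm_deg0.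
  exists [:: d]; split=> // [e|]; last by rewrite big_seq1 eqxx.
  by rewrite inE => /negbTE ->.
by rewrite (hprojP d xf) eqxx.
Qed.

End HomogeneousComponents.

(** The two rings may differ and a shift [s] is allowed, so that one lemma serves graded linear
    maps, restrictions between stalks, and the map sending a polynomial [a] to [a *: x]. *)
Lemma hproj_map (R : realType) (m n : nat) (M : graded_module R m) (N : graded_module R n)
    (f : M -> N) (s d : int) (x : M) :
  {morph f : x y / (x + y)%R} -> (forall d x, gm_deg d x -> gm_deg (d + s)%R (f x)) ->
  hproj (d + s)%R (f x) = f (hproj d x).
Proof.
move=> fD fs; have f0 : f 0%R = 0%R by apply: (addrI (f 0%R)); rewrite -fD !addr0.
have [hd [t [ut t0 xE]]] := hproj_decomp x.
have xf : homog_decomp (f x) (fun e => f (hproj (e - s)%R x)).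
  split=> [e|]; first by rewrite -[e in gm_deg e](subrK s); apply: fs.
  exists [seq (e + s)%R | e <- t]; split.
  - by rewrite map_inj_uniq // => a b /addIr.
  - move=> e es; rewrite t0 //; apply: contra es => es.
    by apply/mapP; exists (e - s)%R; rewrite ?subrK.
  - rewrite big_map {1}xE (big_morph f fD f0).
    by apply: eq_bigr => e _; rewrite addrK.
by rewrite (hprojP _ xf) addrK.
Qed.

(** * Graded linear maps, homogeneous bases and Nakayama's lemma *)

Section GradedMaps.
Local Open Scope ring_scope.
Context {R : realType} {n : nat}.
Implicit Types M N : graded_module R n.

Lemma poly_deg_neg (d : int) (a : {mpoly R[n]}) : poly_deg d a -> d < 0 -> a = 0.
Proof. by case=> // -[k -> _]; rewrite ltz_nat. Qed.

Lemma poly_deg_const (d : int) (a : {mpoly R[n]}) : poly_deg d a -> d != 0 -> a@_0%MM = 0.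
Proof.
case=> [->|[k -> ak] k0]; first by rewrite mcoeff0.
apply: (dhomog_nemf_coeff ak); rewrite /= mdeg0 eq_sym.
by apply: contraNneq k0 => ->; rewrite muln0.
Qed.

Lemma poly_deg_le0 (d : int) (a : {mpoly R[n]}) :
  poly_deg d a -> d <= 0 -> a@_0%MM = 0 -> a = 0.
Proof.
case=> // -[k -> ak]; rewrite lez_nat leqn0 muln_eq0 /= => /eqP k0 a0.
apply/mpolyP => m; rewrite mcoeff0; have [->//|m0] := eqVneq m 0%MM.
by apply: (dhomog_nemf_coeff ak); rewrite k0 /= mdeg_eq0.
Qed.

Lemma mcoeff0_hproj (a : {mpoly R[n]}) :
  (hproj (M := poly_module R n) 0 a)@_0%MM = a@_0%MM.
Proof.
have [hd [s [us s0 aE]]] := hproj_decomp (M := poly_module R n) a.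
(* The degree 0 is put at the head of the list, so that its component occurs exactly once whether or
   not [0] lies in [s]; all other components have no constant term. *)
rewrite [in RHS](_ : a = \sum_(c <- 0 :: rem 0 s) hproj (M := poly_module R n) c a).
  rewrite big_cons raddfD raddf_sum /= big1_seq ?addr0 // => c /andP[_].
  by rewrite mem_rem_uniq // inE => /andP[c0 _]; apply: (poly_deg_const (hd c)).
rewrite {1}aE; have [s1|s1] := boolP (0 \in s).
  by rewrite (perm_big _ (perm_to_rem s1)).
by rewrite rem_id // big_cons s0 // add0r.
Qed.

Definition graded_linear M N (f : M -> N) : Prop :=
  (forall a x y, f (a *: x + y) = a *: f x + f y) /\
  forall d x, gm_deg d x -> gm_deg d (f x).

Section Theory.
Context {M N : graded_module R n} {f : M -> N} (fl : graded_linear f).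

Lemma glD : {morph f : x y / x + y}.
Proof. by move=> x y; have := fl.1 1 x y; rewrite !scale1r. Qed.

Lemma gl0 : f 0 = 0.
Proof. by apply: (addrI (f 0)); rewrite -glD !addr0. Qed.

Lemma glZ a : {morph f : x / a *: x}.
Proof. by move=> x; have := fl.1 a x 0; rewrite gl0 !addr0. Qed.

Lemma glB : {morph f : x y / x - y}.
Proof. by move=> x y; rewrite glD -scaleN1r glZ scaleN1r. Qed.

Lemma gl_sum (I : Type) (r : seq I) (P : pred I) (F : I -> M) :
  f (\sum_(i <- r | P i) F i) = \sum_(i <- r | P i) f (F i).
Proof. exact: (big_morph f glD gl0). Qed.

Lemma gl_comb (I : finType) (a : I -> {mpoly R[n]}) (e : I -> M) :
  f (\sum_i a i *: e i) = \sum_i a i *: f (e i).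
Proof. by rewrite gl_sum; apply: eq_bigr => i _; rewrite glZ. Qed.

Lemma gl_hproj d x : hproj d (f x) = f (hproj d x).
Proof.
rewrite -[d in LHS]addr0; apply: hproj_map; first exact: glD.
by move=> e y; rewrite addr0; apply: fl.2.
Qed.

End Theory.

Lemma graded_linear_comp M N (P : graded_module R n) (f : M -> N) (g : N -> P) :
  graded_linear f -> graded_linear g -> graded_linear (g \o f).
Proof.
by move=> fl gl; split=> [a x y|d x /fl.2/gl.2]; rewrite //= fl.1 gl.1.
Qed.

(** The inverse respects degrees because [f] commutes with the projections: [f] sends the degree [d]
    component of [g x] to that of [x], which is [x] itself. *)
Lemma graded_linear_inv M N (f : M -> N) (g : N -> M) :
  graded_linear f -> cancel f g -> cancel g f -> graded_linear g.
Proof.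
move=> fl fK gK; split=> [a x y|d x dx].
  by apply: (can_inj fK); rewrite fl.1 !gK.
by rewrite -(hproj_id dx) -{1}[x]gK (gl_hproj fl) fK; apply: hproj_deg.
Qed.

Lemma hproj_scale M (D d : int) (a : {mpoly R[n]}) (x : M) : gm_deg d x ->
  hproj D (a *: x) = hproj (M := poly_module R n) (D - d) a *: x.
Proof.
move=> dx; rewrite -[D in LHS](subrK d).
apply: (@hproj_map R n n (poly_module R n) M (fun b : {mpoly R[n]} => b *: x)).
  by move=> b c /=; rewrite scalerDl.
move=> e b /= [->|[k -> bk]]; first by rewrite scale0r; apply: gm_deg0.
by rewrite addrC; apply: gm_degZ.
Qed.

Section HomogeneousBases.
Context {M : graded_module R n} {I : finType}.
Implicit Types (e : I -> M) (d : I -> int) (D : int).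

(** The index is any finite type, so that bases of direct sums can be indexed by pairs. *)
Definition hbasis e d : Prop :=
  [/\ forall i, gm_deg (d i) (e i),
      forall x, exists a : I -> {mpoly R[n]}, x = \sum_i a i *: e i &
      forall a : I -> {mpoly R[n]}, \sum_i a i *: e i = 0 -> forall i, a i = 0].

Lemma hbasis_inj e d (a b : I -> {mpoly R[n]}) : hbasis e d ->
  \sum_i a i *: e i = \sum_i b i *: e i -> a =1 b.
Proof.
move=> [_ _ ind] ab i; apply/subr0_eq; apply: (ind (fun i => a i - b i)).
by under eq_bigr do rewrite scalerBl; rewrite sumrB ab subrr.
Qed.

(** Projecting the sum to degree [D] gives a second expansion, whose coefficients are the components
    of degree [D - d i]; uniqueness of coefficients identifies the two. *)
Lemma hbasis_coef_deg e d (a : I -> {mpoly R[n]}) D : hbasis e d ->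
  gm_deg D (\sum_i a i *: e i) -> forall i, poly_deg (D - d i) (a i).
Proof.
move=> eb aD i.
have -> : a i = hproj (M := poly_module R n) (D - d i) (a i).
  move: i; apply: (hbasis_inj eb); rewrite -{1}(hproj_id aD) raddf_sum.
  by apply: eq_bigr => i _; apply: hproj_scale; case: eb.
exact: (@hproj_deg R n (poly_module R n)).
Qed.

Lemma hbasis_deg_ge0 e d : hbasis e d -> (forall i, 0 <= d i) ->
  forall D (x : M), gm_deg D x -> D < 0 -> x = 0.
Proof.
move=> eb d0 D x; have [_ /(_ x)[a ->] _] := eb.
move=> /(hbasis_coef_deg eb) aD D0; apply: big1 => i _.
by rewrite (poly_deg_neg (aD i)) ?scale0r // subr_lt0 (lt_le_trans D0).
Qed.

Lemma hbasis_neq0 e d i : hbasis e d -> e i <> 0.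
Proof.
move=> [_ _ ind] ei0.
have /ind/(_ i)/eqP : \sum_j (j == i)%:R *: e j = 0.
  apply: big1 => j _; have [->|_] := eqVneq j i; first by rewrite ei0 scaler0.
  by rewrite scale0r.
by rewrite eqxx oner_eq0.
Qed.

Lemma hbasis_extend e d (N : graded_module R n) (y : I -> N) : hbasis e d ->
  (forall i, gm_deg (d i) (y i)) ->
  exists2 f : M -> N, graded_linear f & forall i, f (e i) = y i.
Proof.
move=> eb yd; have [ed /choice[c cE] _] := eb.
exists (fun x => \sum_i c x i *: y i) => [|i].
  split=> [a x z|D x xD].
    rewrite scaler_sumr -big_split; apply: eq_bigr => i _ /=.
    rewrite scalerA -scalerDl; congr (_ *: _); move: i.
    apply: (hbasis_inj eb); rewrite -cE {1}(cE x) {1}(cE z) scaler_sumr -big_split.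
    by apply: eq_bigr => i _ /=; rewrite scalerA scalerDl.
  apply: gm_deg_sum => i _.
  have [->|[k Dk ck]] : poly_deg (D - d i) (c x i).
    by apply: (hbasis_coef_deg eb); rewrite -cE.
    by rewrite scale0r; apply: gm_deg0.
  by rewrite -(subrK (d i) D) Dk addrC; apply: gm_degZ.
have ci j : c (e i) j = (j == i)%:R.
  move: j; apply: (hbasis_inj eb); rewrite -cE (bigD1 i) //= eqxx scale1r.
  by rewrite big1 ?addr0 // => j /negbTE ->; rewrite scale0r.
rewrite (bigD1 i) //= ci eqxx scale1r big1 ?addr0 // => j /negbTE ji.
by rewrite ci ji scale0r.
Qed.

End HomogeneousBases.

Lemma graded_free_hbasis M : graded_free M ->
  exists k (e : 'I_k -> M) d, hbasis e d.
Proof.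
move=> [k [e [d [ed eb]]]]; exists k, e, d; split=> // [x|a a0 i].
  by have [a [-> _]] := eb x; exists a.
have [b [_ bu]] := eb 0.
have a1 : b = [ffun i => a i].
  by apply: bu; rewrite -[LHS]a0; apply: eq_bigr => j _; rewrite ffunE.
have : b = 0.
  by apply: bu; rewrite big1 // => j _; rewrite ffunE scale0r.
by rewrite a1 => /ffunP/(_ i); rewrite !ffunE.
Qed.

Lemma hbasis_graded_free M k (e : 'I_k -> M) d : hbasis e d -> graded_free M.
Proof.
move=> eb; have [ed ex _] := eb; exists k, e, d; split=> // x.
have [a xE] := ex x; exists [ffun i => a i]; split.
  by rewrite xE; apply: eq_bigr => i _; rewrite ffunE.
move=> b; rewrite xE => ab; apply/ffunP => i; rewrite ffunE.
exact: (hbasis_inj eb ab).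
Qed.

Lemma hbasis_reindex M (I J : finType) (e : I -> M) d (h : J -> I) :
  bijective h -> hbasis e d -> hbasis (e \o h) (d \o h).
Proof.
move=> hb [ed ex ind]; have [g hK gK] := hb; split=> [j|x|a a0 j] /=; first exact: ed.
  have [a ->] := ex x; exists (a \o h).
  by rewrite (reindex h) //; apply: onW_bij.
rewrite -[j]hK; apply: (ind (a \o g)); rewrite -[RHS]a0 (reindex h) /=.
  by apply: eq_bigr => i _; rewrite hK.
exact: onW_bij.
Qed.

Lemma poly_module_hbasis M : graded_iso (poly_module R n) M ->
  exists e : unit -> M, hbasis e (fun _ => 0).
Proof.
move=> [f [[g fK gK] fd]]; exists (fun _ => f (1 : {mpoly R[n]})).
have fZ (a : {mpoly R[n]}) : a *: f (1 : {mpoly R[n]}) = f a.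
  by rewrite -linearZ /=; congr (f _); apply: mulr1.
split=> [i|x|a].
- by apply: fd; right; exists 0%N => //; apply: dhomog1.
- by exists (fun _ => g x); rewrite (big_pred1 tt) ?fZ ?gK //; case.
- rewrite (big_pred1 tt) ?fZ; last by case.
  by rewrite -[0](linear0 f) => /(can_inj fK) a0 [].
Qed.

(* The graded form of Nakayama's lemma, for an endomorphism that is onto modulo
   [A^+ M]; a surjective endomorphism of a free module is then bijective. *)
Lemma nakayama M (I : finType) (e : I -> M) d (g : M -> M) :
  hbasis e d -> graded_linear g ->
  (forall y, exists x, exists2 a : I -> {mpoly R[n]},
     forall i, (a i)@_0%MM = 0 & y - g x = \sum_i a i *: e i) ->
  bijective g.
Proof.
move=> eb gl surj; have [ed ex ind] := eb.
(* After projection to degree [d i], the coefficient at [j] has degree [d i - d j]. If this is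
   negative the coefficient is zero; if it is 0, the coefficient is a constant, and its constant
   term vanishes by hypothesis. *)
have step i : exists x, exists2 a : I -> {mpoly R[n]},
    forall j, d i <= d j -> a j = 0 & e i - g x = \sum_i a i *: e i.
  have [x [a a0 xE]] := surj (e i).
  pose b j := hproj (M := poly_module R n) (d i - d j) (a j).
  have bE : e i - g (hproj (d i) x) = \sum_j b j *: e j.
    rewrite -{1}(hproj_id (ed i)) -(gl_hproj gl) -raddfB xE raddf_sum.
    by apply: eq_bigr => j _; apply: hproj_scale.
  exists (hproj (d i) x), b => // j dij.
  have bd : poly_deg (d i - d j) (b j).
    exact: (@hproj_deg R n (poly_module R n)).
  apply: (poly_deg_le0 bd); first by rewrite subr_le0.
  have [dd|/(poly_deg_const bd)//] := eqVneq (d i - d j) 0.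
  by rewrite /b dd mcoeff0_hproj a0.
have img i : exists x, g x = e i.
  (* Induction on the number of basis elements of degree below [d i]: by [step], modulo the image of
     [g], [e i] is a combination of these alone. *)
  have [N] := ubnP #|[pred j | d j < d i]|.
  elim: N i => // N IH i; rewrite ltnS => leN.
  have [x [a a0 xE]] := step i.
  have /choice[z zE] : forall j, exists z, g z = a j *: e j.
    move=> j; have [dij|dji] := leP (d i) (d j).
      by exists 0; rewrite (gl0 gl) a0 // scale0r.
    have [z gz] : exists z, g z = e j.
      apply: IH; apply: leq_trans leN; apply/proper_card/properP; split.
        by apply/fintype.subsetP => k; rewrite !inE => /lt_trans; apply.
      by exists j; rewrite !inE ?ltxx.
    by exists (a j *: z); rewrite (glZ gl) gz.
  exists (x + \sum_j z j); rewrite (glD gl) (gl_sum gl).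
  by under eq_bigr do rewrite zE; rewrite -xE addrC subrK.
have [h0 h0E] := choice img.
(* Only the component of degree [d i] of the chosen preimage is kept; it is still a preimage of
   [e i], and it makes the right inverse [h] graded. *)
have [h hl hE] : exists2 h : M -> M, graded_linear h & forall i, h (e i) = hproj (d i) (h0 i).
  by apply: (hbasis_extend eb) => i; apply: hproj_deg.
have gh : cancel h g.
  move=> x; have [a ->] := ex x; rewrite (gl_comb hl) (gl_comb gl).
  apply: eq_bigr => i _; rewrite hE -(gl_hproj gl) h0E.
  by rewrite hproj_id.
(* Row [i] holds the coordinates of the image of the [i]-th basis element, so composition multiplies
   matrices in the order of application. A one-sided inverse of a square matrix over a commutative
   ring is two-sided, hence [h] is also a left inverse. *)
have endo_mx (f : M -> M) : graded_linear f -> exists A : 'M[{mpoly R[n]}]_#|I|,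
    forall i, f (e (enum_val i)) = \sum_j A i j *: e (enum_val j).
  move=> fl; have /choice[c cE] : forall i : 'I_#|I|, exists a : I -> {mpoly R[n]},
    f (e (enum_val i)) = \sum_j a j *: e j by move=> i; apply: ex.
  exists (\matrix_(i, j) c i (enum_val j)) => i; rewrite cE (reindex (@enum_val I I)) /=.
    by apply: eq_bigr => j _; rewrite mxE.
  by apply: onW_bij; apply: enum_val_bij.
have mx_comp (f1 f2 : M -> M) (A B : 'M[{mpoly R[n]}]_#|I|) : graded_linear f2 ->
    (forall i, f1 (e (enum_val i)) = \sum_j A i j *: e (enum_val j)) ->
    (forall i, f2 (e (enum_val i)) = \sum_j B i j *: e (enum_val j)) ->
    forall i, f2 (f1 (e (enum_val i))) = \sum_j (A *m B) i j *: e (enum_val j).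
  move=> f2l AE BE i; rewrite AE (gl_comb f2l).
  under eq_bigr do rewrite BE scaler_sumr.
  rewrite exchange_big; apply: eq_bigr => j _ /=; rewrite mxE scaler_suml.
  by apply: eq_bigr => k _; rewrite scalerA.
have [A AE] := endo_mx g gl; have [B BE] := endo_mx h hl.
have BA : B *m A = 1%:M.
  apply/matrixP => i j.
  have /(hbasis_inj (hbasis_reindex (@enum_val_bij I) eb)) :
    \sum_j (B *m A) i j *: e (enum_val j) = \sum_j (1%:M : 'M_#|I|) i j *: e (enum_val j).
    rewrite -(mx_comp _ _ _ _ gl BE AE) gh (bigD1 i) //= mxE eqxx scale1r.
    by rewrite big1 ?addr0 // => k ki; rewrite mxE eq_sym (negPf ki) scale0r.
  exact.
exists h => // x.
have [a ->] := ex x; rewrite (gl_comb gl) (gl_comb hl); apply: eq_bigr => i _.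
congr (_ *: _); rewrite -[i]enum_rankK (mx_comp _ _ _ _ hl AE BE) (mulmx1C BA).
rewrite (bigD1 (enum_rank i)) //= mxE eqxx scale1r big1 ?addr0 // => k ki.
by rewrite mxE eq_sym (negPf ki) scale0r.
Qed.

(** The matrices of [i] and [p] multiply to the identity. Their constant terms between basis
    elements of degree [D] form real matrices with the same property, and the rank bounds the
    size. *)
Lemma retract_card_le M N (I J : finType) (e : I -> M) d (e' : J -> N) d'
    (i : M -> N) (p : N -> M) D :
  hbasis e d -> hbasis e' d' -> graded_linear i -> graded_linear p -> cancel i p ->
  (#|[pred a | d a == D]| <= #|[pred b | d' b == D]|)%N.
Proof.
move=> eb eb' il pl ipK; have [ed ex _] := eb; have [ed' ex' _] := eb'.
have /choice[A AE] : forall a, exists c : J -> {mpoly R[n]}, i (e a) = \sum_b c b *: e' b.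
  by move=> a; apply: ex'.
have /choice[B BE] : forall b, exists c : I -> {mpoly R[n]}, p (e' b) = \sum_a c a *: e a.
  by move=> b; apply: ex.
have AB a : (fun a' => \sum_b A a b * B b a') =1 (fun a' => (a == a')%:R).
  apply: (hbasis_inj eb); rewrite [RHS](bigD1 a) //= eqxx scale1r [X in _ + X]big1; last first.
    by move=> a' aa'; rewrite eq_sym (negPf aa') scale0r.
  rewrite addr0 -[RHS]ipK AE (gl_comb pl); under [RHS]eq_bigr do rewrite BE scaler_sumr.
  rewrite exchange_big; apply: eq_bigr => a' _ /=; rewrite scaler_suml.
  by apply: eq_bigr => b _; rewrite scalerA.
(* The entry at [a], [b] is homogeneous of degree [d a - d' b]; hence only elements of degree [D]
   contribute to the constant terms of the product. *)
have A0 a b : d a != d' b -> (A a b)@_0%MM = 0.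
  move=> dab; apply: (@poly_deg_const (d a - d' b)); last by rewrite subr_eq0.
  by apply: (hbasis_coef_deg eb'); rewrite -AE; apply: il.2.
set P := [pred a | _]; set Q := [pred b | _].
pose A' : 'M[R]_(#|P|, #|Q|) := \matrix_(a, b) (A (enum_val a) (enum_val b))@_0%MM.
pose B' : 'M[R]_(#|Q|, #|P|) := \matrix_(b, a) (B (enum_val b) (enum_val a))@_0%MM.
have AB' : A' *m B' = 1%:M.
  apply/matrixP => a a'; rewrite !mxE.
  have := congr1 (mcoeff 0%MM) (AB (enum_val a) (enum_val a')).
  rewrite raddf_sum /= (bigID Q) /= [X in _ + X]big1 ?addr0; last first.
    move=> b bD; rewrite rmorphM /= A0 ?mul0r // eq_sym.
    by have := enum_valP a; rewrite inE => /eqP ->.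
  rewrite (inj_eq enum_val_inj) rmorph_nat => <-.
  rewrite [RHS](eq_bigl (mem Q)) // [RHS]big_enum_val.
  by apply: eq_bigr => b _; rewrite !mxE rmorphM.
by have := mulmx_max_rank A' B'; rewrite AB' mxrank1.
Qed.

End GradedMaps.

(** * Minimal sheaves *)

Section Faces.
Local Open Scope ring_scope.
Context {R : realType} {V : vectType R}.
Implicit Types (c t u m r : cone V) (F : fan V).

Lemma face_refl c : face c c.
Proof. exact: supported_face_refl. Qed.

Lemma origin_face c : face origin c.
Proof. exact: cone_pointed. Qed.

Lemma face_subset t c : face t c -> (cone_set t `<=` cone_set c)%classic.
Proof. by move=> [l _ ->] x []. Qed.

Lemma face_antisym t c : face t c -> face c t -> t = c.
Proof. by move=> /face_subset tc /face_subset ct; apply/cone_eq/seteqP. Qed.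

Lemma face_between t m c : face t c ->
  (cone_set t `<=` cone_set m)%classic -> (cone_set m `<=` cone_set c)%classic -> face t m.
Proof.
move=> [l l0 tE] tm mc; exists l => [x /mc/l0 //|].
apply/seteqP; split=> x => [tx|[mx lx]].
  by split; [exact: tm|move: tx; rewrite tE => -[]].
by rewrite tE; split=> //; apply: mc.
Qed.

(** The functional cutting out [t] vanishes on the span of [t]; if that were the span of [c], it
    would vanish on [c]. The dimension of the span thus serves as induction measure. *)
Lemma face_dim_lt t c : face t c -> t <> c ->
  (\dim (cone_span t) < \dim (cone_span c))%N.
Proof.
move=> tc ne; have [l l0 tE] := tc; rewrite ltnNge; apply/negP => ct; apply: ne.
have sub : (cone_span t <= cone_span c)%VS.
  apply/cone_spanP => x /(face_subset tc); move: x.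
  exact/(cone_spanP c (cone_span c)).
have E : cone_span t = cone_span c.
  by apply/eqP; rewrite eqEdim sub.
have tl : (cone_span t <= lker (linfun (l : V -> R^o)))%VS.
  by apply/cone_spanP => x; rewrite tE memv_ker lfunE /= => -[_ ->].
apply/cone_eq/seteqP; split; first exact: face_subset.
move=> x cx; rewrite tE; split=> //; apply/eqP.
have : x \in cone_span c by move: x cx; apply/(cone_spanP c (cone_span c)).
by rewrite -E => /(subvP tl); rewrite memv_ker lfunE.
Qed.

End Faces.

(** * Restriction of polynomial functions to a subspace *)

Section Restriction.
Local Open Scope ring_scope.
Context {R : realType} {V : vectType R}.

Lemma sym_res_mcoeff0 (W U : {vspace V}) (a : {mpoly R[\dim W]}) :
  (sym_res U a)@_0%MM = a@_0%MM.
Proof.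
rewrite /sym_res comp_mpolyEX raddf_sum [in RHS](mpolyE a) raddf_sum /=.
apply: eq_bigr => m _; rewrite !mcoeffZ; congr (_ * _).
rewrite comp_mpolyX rmorph_prod /= mcoeffX.
have [->|m0] := eqVneq m 0%MM.
  by rewrite big1 // => i _; rewrite mnm0E expr0 rmorph1.
have [i mi] : exists i, m i != 0%N.
  apply: contrapT => /forallNP h; case/eqP: m0; apply/mnmP => i.
  by rewrite mnm0E; apply/eqP; have /negP := h i; rewrite negbK.
rewrite (bigD1 i) //= rmorphXn /= tnth_mktuple raddf_sum /= big1 => [|j _].
  by rewrite expr0n (negbTE mi) mul0r.
by rewrite mcoeffZ mcoeffX mnm1_eq0 mulr0.
Qed.

(** A polynomial function on [U] extends to the whole space by composing it with the projection onto
    [U]; [al j] is the pullback of the [j]-th coordinate of [U]. *)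
Lemma sym_res_surj (U : {vspace V}) (p : {mpoly R[\dim U]}) :
  exists a : {mpoly R[\dim (fullv : {vspace V})]}, sym_res U a = p.
Proof.
pose B := vbasis (fullv : {vspace V}).
pose al (j : 'I_(\dim U)) : {mpoly R[\dim (fullv : {vspace V})]} :=
  \sum_(i < _) coord (vbasis U) j (projv U B`_i) *: 'X_i.
have alE j : sym_res U (al j) = 'X_j.
  have cE (k : 'I_(\dim U)) :
      \sum_(i < _) coord (vbasis U) j (projv U B`_i) * coord B i (vbasis U)`_k = (k == j)%:R.
    rewrite -(coord_free k j (basis_free (vbasisP U))).
    have uk : (vbasis U)`_k \in U by apply/vbasis_mem/mem_nth; rewrite size_tuple.
    rewrite -[in RHS](projv_id uk) [in RHS](coord_vbasis (memvf (vbasis U)`_k)).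
    by rewrite !linear_sum; apply: eq_bigr => i _; rewrite !linearZ /= mulrC.
  rewrite /sym_res /al raddf_sum /=.
  under eq_bigr do rewrite comp_mpolyZ comp_mpolyXU nth_mktuple scaler_sumr.
  rewrite exchange_big (bigD1 j) //= [X in _ + X]big1 => [|k kj].
    by under eq_bigr do rewrite scalerA; rewrite -scaler_suml cE eqxx scale1r addr0.
  under eq_bigr do rewrite scalerA.
  by rewrite -scaler_suml cE (negbTE kj) scale0r.
exists (p \mPo [tuple al j | j < \dim U]).
rewrite comp_mpolyEX [in RHS](mpolyE p) /sym_res raddf_sum; apply: eq_bigr => m _.
rewrite /= comp_mpolyZ comp_mpolyX rmorph_prod /= mpolyXE_id; congr (_ *: _).
by apply: eq_bigr => i _; rewrite rmorphXn /= tnth_mktuple -/(sym_res U _) alE.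
Qed.

End Restriction.

(** * Stalks modulo the ideal of positive degree, and morphisms over a star *)

Section SheafTheory.
Local Open Scope ring_scope.
Context {R : realType} {V : vectType R} {F : fan V}.
Implicit Types (c t u m r : cone V) (M N : sheaf F).

Section Stalks.
Context {M : sheaf F}.

Lemma res0 c t : fan_cones F c -> face t c -> res t (0 : M c) = 0.
Proof.
by move=> Fc tc; apply: (addrI (res t (0 : M c))); rewrite -res_add // !addr0.
Qed.

Lemma res_comb c t (I : finType) (a : I -> {mpoly R[\dim (cone_span c)]}) (e : I -> M c) :
  fan_cones F c -> face t c ->
  res t (\sum_i a i *: e i) = \sum_i sym_res (cone_span t) (a i) *: res t (e i).
Proof.
move=> Fc tc; have rD : {morph (@res _ _ _ M c t) : x y / x + y}.
  by move=> x y; apply: res_add.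
rewrite (big_morph _ rD (res0 Fc tc)); apply: eq_bigr => i _.
exact: res_scale.
Qed.

Lemma hproj_res c t d (x : M c) : fan_cones F c -> face t c ->
  res t (hproj d x) = hproj d (res t x).
Proof.
move=> Fc tc; rewrite -[d in RHS]addr0; apply/esym/hproj_map.
  by move=> y z; apply: res_add.
by move=> e y; rewrite addr0; apply: res_deg.
Qed.

Lemma resB c t (x y : M c) : fan_cones F c -> face t c ->
  res t (x - y) = res t x - res t y.
Proof. by move=> Fc tc; apply/esym/(canLR (addrK _)); rewrite -res_add // subrK. Qed.

(** The coefficients lift to the symmetric algebra of the whole space by [sym_res_surj], with the
    same constant terms. Together with [stalk_plus_coef], this describes the submodule in
    coordinates. *)
Lemma coef_stalk_plus c (I : finType) (a : I -> {mpoly R[\dim (cone_span c)]}) (e : I -> M c) :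
  (forall i, (a i)@_0%MM = 0) -> stalk_plus (\sum_i a i *: e i).
Proof.
move=> a0; have /choice[b bE] := fun i => sym_res_surj (a i).
exists #|I|, (fun i => b (enum_val i)), (fun i => e (enum_val i)); split=> [i|].
  by rewrite /sym_plus -(sym_res_mcoeff0 (cone_span c)) bE.
rewrite (reindex (@enum_val I I)) /=; last by apply: onW_bij; apply: enum_val_bij.
by apply: eq_bigr => i _; rewrite bE.
Qed.

Section Basis.
Context {c : cone V} {I : finType} {e : I -> M c} {d : I -> int} (eb : hbasis e d).

Lemma stalk_plus_coef (x : M c) : stalk_plus x ->
  exists2 a : I -> {mpoly R[\dim (cone_span c)]},
    forall i, (a i)@_0%MM = 0 & x = \sum_i a i *: e i.
Proof.
move=> [k [a [y [a0 ->]]]]; have [_ /choice[b bE] _] := eb.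
exists (fun i => \sum_j sym_res (cone_span c) (a j) * b (y j) i) => [i|].
  rewrite raddf_sum /= big1 // => j _; rewrite rmorphM /= sym_res_mcoeff0.
  by rewrite [_@__]a0 mul0r.
under eq_bigr => j _ do rewrite (bE (y j)) scaler_sumr.
rewrite exchange_big; apply: eq_bigr => i _ /=; rewrite scaler_suml.
by apply: eq_bigr => j _; rewrite scalerA.
Qed.

Lemma hbasis_bar_dim (D : int) : bar_dim M c D #|[pred i | d i == D]|.
Proof.
set Q := [pred i | _]; pose b (j : 'I_#|Q|) := e (enum_val j).
have bQ (j : 'I_#|Q|) : d (enum_val j) = D by have := enum_valP j; rewrite inE => /eqP.
(* [q r] extends the real coefficients [r] by zero to all basis indices; the sum has at most one
   term. *)
pose q (r : 'I_#|Q| -> R) i : {mpoly R[\dim (cone_span c)]} :=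
  \sum_(j | enum_val j == i) (r j)%:MP.
have qE (r : 'I_#|Q| -> R) : \sum_j (r j)%:MP *: b j = \sum_i q r i *: e i.
  under [RHS]eq_bigr do rewrite scaler_suml.
  rewrite (exchange_big_dep xpredT) //=; apply: eq_bigr => j _.
  by rewrite (big_pred1 (enum_val j)) // => i; rewrite eq_sym.
have q0 (r : 'I_#|Q| -> R) j : (q r (enum_val j))@_0%MM = r j.
  rewrite /q (big_pred1 j) => [|k]; last exact: (inj_eq enum_val_inj).
  by rewrite mcoeffC eqxx mulr1.
exists b; split=> [j|x xD]; first by rewrite -(bQ j); case: eb.
have [_ /(_ x)[a xE] _] := eb; exists [ffun j => (a (enum_val j))@_0%MM]; split.
  rewrite qE xE -sumrB; under eq_bigr do rewrite -scalerBl.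
  apply: coef_stalk_plus => i; have [dD|dD] := eqVneq (d i) D.
    have iQ : i \in Q by rewrite inE dD.
    by rewrite -(enum_rankK_in iQ iQ) mcoeffB q0 ffunE subrr.
  rewrite /q big_pred0 => [|j]; last first.
    by apply: contra_neqF dD => /eqP <-.
  rewrite subr0; apply: (@poly_deg_const _ _ (D - d i)); last by rewrite subr_eq0 eq_sym.
  by apply: (hbasis_coef_deg eb); rewrite -xE.
move=> r /stalk_plus_coef[a' a'0 /eqP]; rewrite qE xE subr_eq -big_split => /eqP sE.
have aE : a =1 (fun i => a' i + q r i).
  by apply: (hbasis_inj eb); rewrite sE; apply: eq_bigr => i _; rewrite scalerDl.
by apply/ffunP => j; rewrite ffunE aE mcoeffD a'0 q0 add0r.
Qed.

End Basis.
End Stalks.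

Lemma section_plusI M (T : finType) (a : T -> {mpoly R[\dim (fullv : {vspace V})]})
    (y : T -> forall c, M c) (U : set (cone V)) (s : forall c, M c) :
  (forall i, sym_plus (a i)) -> (forall i, is_section U (y i)) ->
  (forall c, U c -> s c = \sum_i sym_res (cone_span c) (a i) *: y i c) ->
  section_plus U s.
Proof.
move=> a0 ysec sE; exists #|T|, (a \o enum_val), (y \o enum_val).
split=> [i|i|c Uc] /=; [exact: a0|exact: ysec|].
rewrite sE // (reindex (@enum_val T T)) //=.
by apply: onW_bij; apply: enum_val_bij.
Qed.

(* [s] is a section only over the proper faces of [c] that contain [r]. It
   extends to the subfan they generate because two of them meet in a third. *)
Lemma star_flabby N r c (s : forall t, N t) : flabby N -> fan_cones F c -> face r c ->
  (forall t u, boundary c t -> face r u -> face u t -> res u (s t) = s u) ->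
  exists x : N c, forall t, boundary c t -> face r t -> res t x = s t.
Proof.
move=> flN Fc rc sE.
have Fb t : boundary c t -> fan_cones F t by move=> [/(fan_face Fc)].
pose P u t := [/\ boundary c t, face r t & face u t].
pose s' u : N u := if pselect (exists t, P u t) is left h then res u (s (sval (cid h))) else 0.
have s'E u t : P u t -> s' u = res u (s t).
  move=> Put; rewrite /s'; case: pselect => [h|[]]; last by exists t.
  case: cid => t' /= [bt' rt' ut']; have [bt rt ut] := Put.
  (* Independence of the chosen [t]: the intersection [m] of two candidates has both [r] and [u] as
     faces, so [s] is compatible at [m] and both restrictions to [u] pass through it. *)
  have [m [mE mt mt']] := fan_meet (Fb _ bt) (Fb _ bt').
  have msub x : cone_set t x -> cone_set t' x -> cone_set m x by rewrite mE; split.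
  have rm : face r m.
    apply: (face_between rt); last exact: face_subset.
    by move=> x rx; apply: msub; [exact: (face_subset rt)|exact: (face_subset rt')].
  have um : face u m.
    apply: (face_between ut); last exact: face_subset.
    by move=> x ux; apply: msub; [exact: (face_subset ut)|exact: (face_subset ut')].
  rewrite -(res_comp _ (Fb _ bt) mt um) -(res_comp _ (Fb _ bt') mt' um).
  by rewrite (sE t m) // (sE t' m) //.
have [|u v [t Put] _ vu|s'' s''sec s''E] := flN [set u | exists t, P u t]%classic s'.
- split=> [u [t [bt _ ut]]|u v [t [bt rt ut]] vu].
    exact: fan_face (Fb _ bt) ut.
  by exists t; split=> //; apply: face_trans vu ut.
- rewrite (s'E _ _ Put); have [bt rt ut] := Put.
  rewrite (res_comp _ (Fb _ bt) ut vu); apply/esym/s'E; split=> //.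
  exact: face_trans vu ut.
exists (s'' c) => t bt rt; have Ptt : P t t by split=> //; apply: face_refl.
rewrite s''sec //; [|exact: Fb|by case: bt].
by rewrite s''E; [rewrite (s'E _ _ Ptt) res_id //; apply: Fb|exists t].
Qed.

Definition star_morphism M N r (f : forall c, M c -> N c) : Prop :=
  forall c, star F r c -> graded_linear (@f c) /\
    forall t (x : M c), face r t -> face t c -> f t (res t x) = res t (f c x).

Lemma star_morphism_comp M N (P : sheaf F) r (f : forall c, M c -> N c)
    (g : forall c, N c -> P c) :
  star_morphism r f -> star_morphism r g -> star_morphism r (fun c x => g c (f c x)).
Proof.
move=> fm gm c rc; have [fl fr] := fm c rc; have [gl gr] := gm c rc.
split; first exact: (graded_linear_comp fl gl).
by move=> t x rt tc; rewrite fr // gr.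
Qed.

(** Induction on dimension: the images of a basis element over the boundary are already known,
    flabbiness of [N] lifts them to the stalk, and freeness of [M] extends the lifts to a linear
    map. *)
Lemma extend_star_morphism M N r (f0 : M r -> N r) :
  (forall c, star F r c -> graded_free (M c)) -> flabby N -> graded_linear f0 ->
  exists2 f : forall c, M c -> N c, star_morphism r f & f r = f0.
Proof.
move=> free flN f0l.
suff [f [fr fE]] : exists f : forall c, M c -> N c, f r = f0 /\
    forall c, star F r c -> (\dim (cone_span c) < (\dim (fullv : {vspace V})).+1)%N ->
    graded_linear (f c) /\
    forall t (x : M c), boundary c t -> face r t -> f t (res t x) = res t (f c x).
  exists f => // c rc; have := fE c rc; rewrite ltnS dimvS ?subvf // => -[]// fl fres.
  split=> // t x rt tc; have [->|tc'] := pselect (t = c).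
    by rewrite !res_id //; case: rc.
  exact: fres.
elim: _.+1 => [|n [f [fr fE]]].
  (* At stage 0 only the value at [r] matters; the zero maps elsewhere are placeholders. *)
  exists (fun c => if pselect (r = c) is left e
                   then eq_rect r (fun c => M c -> N c) f0 c e else fun=> 0).
  by split=> //; case: pselect => // e; rewrite (Prop_irrelevance e erefl).
(* One stage of the construction: maps at [r] and in dimension below [n] are kept, and those in
   dimension [n] over the star are built. *)
have ext c : exists g : M c -> N c,
    ((c = r \/ (\dim (cone_span c) < n)%N) -> g = f c) /\
    (star F r c -> (\dim (cone_span c) < n.+1)%N -> graded_linear g /\
    forall t (x : M c), boundary c t -> face r t -> f t (res t x) = res t (g x)).
  have [cn|nc] := ltnP (\dim (cone_span c)) n.
    by exists (f c); split=> // rc _; apply: fE.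
  have [->|cr] := pselect (c = r).
    exists (f r); split=> // _ _; rewrite fr; split=> // t x [tr ne] rt.
    by case: ne; apply: face_antisym.
  have [[rc cn]|nrc] := pselect (star F r c /\ (\dim (cone_span c) < n.+1)%N); last first.
    by exists (f c); split=> // rc cn; case: nrc.
  have [Fc fc] := rc; have [k [e [d eb]]] := graded_free_hbasis (free c rc).
  have bE t : boundary c t -> face r t -> star F r t /\ (\dim (cone_span t) < n)%N.
    move=> [tc ne] rt; split; first by split=> //; apply: fan_face Fc tc.
    by rewrite -ltnS; apply: leq_trans cn; rewrite ltnS; apply: face_dim_lt.
  have /choice[y yE] i : exists y : N c, forall t, boundary c t -> face r t ->
      res t y = f t (res t (e i)).
    apply: star_flabby => // t u bt ru ut.
    have [rt tn] := bE t bt (face_trans ru ut).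
    have [->|ne] := pselect (u = t); first by rewrite res_id //; case: rt.
    by rewrite -(fE t rt tn).2 // res_comp //; case: bt.
  (* The lift [y i] need not be homogeneous. Its component of degree [d i] has the same
     restrictions, since these are already homogeneous of that degree. *)
  have [i|g gl gE] := hbasis_extend (y := fun i => hproj (d i) (y i)) eb.
    exact: hproj_deg.
  have [ed ex _] := eb; exists g; split=> [[]//|_ _].
  split=> // t x bt rt; have [tc _] := bt; have [rst tn] := bE t bt rt.
  have [fl _] := fE t rst tn; have [a ->] := ex x.
  rewrite (gl_comb gl) !res_comb // (gl_comb fl); apply: eq_bigr => i _.
  rewrite gE hproj_res // yE // hproj_id //; apply: fl.2.
  by apply: res_deg => //; apply: ed.
pose f' c := sval (cid (ext c)).
have f'E c : (c = r \/ (\dim (cone_span c) < n)%N) -> f' c = f c.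
  exact: (svalP (cid (ext c))).1.
exists f'; split=> [|c rc cn]; first by rewrite f'E; [|left].
have [gl gE] := (svalP (cid (ext c))).2 rc cn; split=> // t x bt rt.
rewrite -gE // f'E //; right; rewrite -ltnS; apply: leq_trans cn; rewrite ltnS.
by case: bt; apply: face_dim_lt.
Qed.

(* Induction on the dimension of [c]: by [bar_boundary_iso] and Nakayama's lemma,
   the stalk at [c] is recovered from the sections over the boundary of [c]. *)
Lemma star_endo_bijective (K : sheaf F) r (g : forall c, K c -> K c) :
  (forall c, fan_cones F c -> ~ face r c -> forall x : K c, x = 0) ->
  (forall c, star F r c -> graded_free (K c)) ->
  (forall c, star F r c -> c <> r -> bar_boundary_iso K c) ->
  star_morphism r g -> bijective (g r) ->
  forall c, star F r c -> bijective (g c).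
Proof.
move=> K0 free iso gm gr c; have [n] := ubnP (\dim (cone_span c)).
elim: n c => // n IH c; rewrite ltnS => cn rc.
have [->//|cr] := pselect (c = r); have [Fc fc] := rc.
have Fb t : boundary c t -> fan_cones F t by move=> [/(fan_face Fc)].
(* Inverses are available on the proper faces above [r]; elsewhere the identity is a default,
   harmless because [K] vanishes on faces not above [r]. *)
have hex t : exists h : K t -> K t,
    boundary c t -> face r t -> cancel (g t) h /\ cancel h (g t).
  have [[bt rt]|nbt] := pselect (boundary c t /\ face r t); last first.
    by exists id => bt rt; case: nbt.
  have [|h hK Kh] := IH t _ (conj (Fb t bt) rt); last by exists h.
  by apply: leq_trans cn; case: bt; apply: face_dim_lt.
pose h t := sval (cid (hex t)).
have hE t : boundary c t -> face r t -> cancel (g t) (h t) /\ cancel (h t) (g t).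
  exact: (svalP (cid (hex t))).
have [k [e [d eb]]] := graded_free_hbasis (free c rc); have [gl gres] := gm c rc.
apply: (nakayama eb gl) => y.
have [inj surj] := iso c rc cr.
have [|x [l [a [z [a0 zsec zE]]]]] := surj (fun t => h t (res t y)).
  move=> t u bt bu ut; have [ru|nru] := pselect (face r u); last first.
    by rewrite (K0 u (Fb u bu) nru (h _ _)); apply: K0 => //; apply: Fb.
  have rt := face_trans ru ut; have [hK Kh] := hE t bt rt; have [hK' Kh'] := hE u bu ru.
  apply: (can_inj hK'); rewrite Kh' (gm t (conj (Fb t bt) rt)).2 // Kh.
  by rewrite res_comp //; case: bt.
exists x; apply: stalk_plus_coef eb _ _; apply: inj.
(* Over the boundary, [y - g x] is the image under [g] of the difference expanded by [zE]; applying
   [g] to the sections [z i] gives the required expansion. *)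
exists l, a, (fun i t => g t (z i t)); split=> // [i t u bt bu ut|t bt].
  have [ru|nru] := pselect (face r u); last first.
    by rewrite (K0 u (Fb u bu) nru (g _ _)); apply: K0 => //; apply: Fb.
  have rt := face_trans ru ut.
  by rewrite -(gm t (conj (Fb t bt) rt)).2 // zsec.
have [rt|nrt] := pselect (face r t); last first.
  by rewrite (K0 t (Fb t bt) nrt (res _ _)) (K0 t (Fb t bt) nrt (\sum_(i < l) _)).
have [glt _] := gm t (conj (Fb t bt) rt); have [hK Kh] := hE t bt rt.
rewrite resB //; last by case: bt.
rewrite -gres //; last by case: bt.
by rewrite -[res t y]Kh -(glB glt) zE // (gl_comb glt).
Qed.

(** This is the retract argument. The conditions on [K] are conditions of minimality that pass to
    direct sums of shifts, and the two stalks at [r] are matched by bases with the same degrees. *)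
Lemma minimal_rank_le (K M : sheaf F) r (I0 : finType) (e0 : I0 -> K r) (e0' : I0 -> M r) d0 :
  (forall c, fan_cones F c -> ~ face r c -> forall x : K c, x = 0) ->
  (forall c, star F r c -> graded_free (K c)) -> flabby K ->
  (forall c, star F r c -> c <> r -> bar_boundary_iso K c) ->
  (forall c, star F r c -> graded_free (M c)) -> flabby M ->
  hbasis e0 d0 -> hbasis e0' d0 ->
  forall c (I J : finType) (e : I -> K c) d (e' : J -> M c) d' (D : int), star F r c ->
  hbasis e d -> hbasis e' d' ->
  (#|[pred a | d a == D]| <= #|[pred b | d' b == D]|)%N.
Proof.
move=> K0 freeK flK isoK freeM flM b0 b0' c I J e d e' d' D rc eb eb'.
have [e0d ex0 _] := b0; have [e0'd _ _] := b0'.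
have [i0 i0l i0E] := hbasis_extend b0 e0'd.
have [p0 p0l p0E] := hbasis_extend b0' e0d.
have [i im ir] := extend_star_morphism freeK flM i0l.
have [p pm pr] := extend_star_morphism freeM flK p0l.
have gm := star_morphism_comp im pm.
have [|h gK hK] := star_endo_bijective K0 freeK isoK gm _ rc.
  rewrite ir pr; exists id => x; have [a ->] := ex0 x.
    by rewrite (gl_comb i0l) (gl_comb p0l); apply: eq_bigr => j _; rewrite i0E p0E.
  by rewrite (gl_comb i0l) (gl_comb p0l); apply: eq_bigr => j _; rewrite i0E p0E.
have [il _] := im c rc; have [pl _] := pm c rc.
(* The composite of [i] and [p] is invertible at [c] but need not be the identity, so [p] is
   corrected by the inverse [h]. *)
have hl := graded_linear_inv (gm c rc).1 gK hK.
exact: (retract_card_le D eb eb' il (graded_linear_comp pl hl)).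
Qed.

End SheafTheory.

(** * Direct sums of shifted sheaves *)

Section DirectSumModule.
Local Open Scope ring_scope.
Context {R : realType} {n m : nat} (M : graded_module R n) (s : 'I_m -> int).
Implicit Types (D : int) (x y : {ffun 'I_m -> M}).

(** The summand [j] is shifted so that an element of degree 0 in [M] acquires degree [s j]. *)
Definition dsum_deg D : set {ffun 'I_m -> M} :=
  [set x | forall j, gm_deg (D - s j) (x j)]%classic.

Fact dsum_deg0 D : dsum_deg D 0.
Proof. by move=> j; rewrite ffunE; apply: gm_deg0. Qed.

Fact dsum_degB D x y : dsum_deg D x -> dsum_deg D y -> dsum_deg D (x - y).
Proof. by move=> xD yD j; rewrite !ffunE; apply: gm_degB. Qed.

Fact dsum_degZ D (k : nat) (a : {mpoly R[n]}) x : a \is k.-homog ->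
  dsum_deg D x -> dsum_deg (D + (2 * k)%:Z) (a *: x).
Proof. by move=> ak xD j; rewrite ffunE addrAC; apply: gm_degZ. Qed.

Fact dsum_decomp x : exists u : seq int, exists f : int -> {ffun 'I_m -> M},
  [/\ uniq u, forall D, dsum_deg D (f D) & x = \sum_(D <- u) f D].
Proof.
have /choice[t tP] j := (hproj_decomp (x j)).2.
pose u := undup (flatten [seq [seq d + s j | d <- t j] | j <- enum 'I_m]).
exists u, (fun D => [ffun j => hproj (D - s j) (x j)]); split; first exact: undup_uniq.
  by move=> D j; rewrite ffunE; apply: hproj_deg.
apply/ffunP => j; have [ut t0 xE] := tP j; rewrite sum_ffunE.
under eq_bigr do rewrite ffunE.
rewrite (@eq_sum_supp _ _ M [seq d + s j | d <- t j]) ?undup_uniq //.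
- by rewrite big_map {1}xE; apply: eq_bigr => d _; rewrite addrK.
- by rewrite map_inj_uniq // => a b /addIr.
- move=> D Dj; rewrite mem_undup; apply/flattenP.
  by exists [seq d + s j | d <- t j] => //; apply: map_f; rewrite mem_enum.
- move=> D Dj; rewrite t0 //; apply: contra Dj => Dj.
  by apply/mapP; exists (D - s j); rewrite ?subrK.
Qed.

Fact dsum_indep (u : seq int) (f : int -> {ffun 'I_m -> M}) : uniq u ->
  (forall D, dsum_deg D (f D)) -> \sum_(D <- u) f D = 0 ->
  forall D, D \in u -> f D = 0.
Proof.
move=> uu fD f0 D Du; apply/ffunP => j; rewrite ffunE -[D](subrK (s j)).
apply: (@gm_indep _ _ M [seq d - s j | d <- u] (fun d => f (d + s j) j)).
- by rewrite map_inj_uniq // => a b /addIr.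
- by move=> d; have := fD (d + s j) j; rewrite addrK.
- rewrite big_map; under eq_bigr do rewrite subrK.
  by rewrite -sum_ffunE f0 ffunE.
- exact: map_f.
Qed.

Definition dsum_module : graded_module R n :=
  GradedModule dsum_deg0 dsum_degB dsum_degZ dsum_decomp dsum_indep.

Definition dsum_inj (j : 'I_m) (x : M) : dsum_module := [ffun k => if k == j then x else 0].

Lemma dsum_comb (I : finType) (a : 'I_m -> I -> {mpoly R[n]}) (e : 'I_m -> I -> M) j :
  (\sum_p a p.1 p.2 *: dsum_inj p.1 (e p.1 p.2) : dsum_module) j = \sum_i a j i *: e j i.
Proof.
rewrite -(pair_bigA _ (fun k i => a k i *: dsum_inj k (e k i))) sum_ffunE (bigD1 j) //=.
rewrite sum_ffunE [X in _ + X]big1 ?addr0 => [|k kj].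
  by apply: eq_bigr => i _; rewrite !ffunE eqxx.
rewrite sum_ffunE big1 // => i _.
by rewrite !ffunE eq_sym (negbTE kj) scaler0.
Qed.

Lemma dsum_hbasis (I : finType) (e : I -> M) d : hbasis e d ->
  hbasis (fun p : 'I_m * I => dsum_inj p.1 (e p.2)) (fun p => s p.1 + d p.2).
Proof.
move=> [ed ex ind]; split=> [[j i] k|x|a a0 [j i]].
- rewrite ffunE /=; case: eqP => [->|_]; last exact: gm_deg0.
  by rewrite addrC addKr.
- have /choice[a aE] j := ex ((x : {ffun 'I_m -> M}) j).
  exists (fun p => a p.1 p.2); apply/ffunP => j.
  by rewrite (dsum_comb a (fun=> e)) -aE.
- apply: (ind (fun i => a (j, i))).
  rewrite -(dsum_comb (fun j i => a (j, i)) (fun=> e) j).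
  rewrite (_ : \sum_p _ = 0); first by rewrite ffunE.
  by rewrite -[RHS]a0; apply: eq_bigr => -[].
Qed.

End DirectSumModule.

(** * The direct sum as a sheaf: flabbiness, freeness and the boundary condition *)

Section DirectSumSheaf.
Local Open Scope ring_scope.
Context {R : realType} {V : vectType R} {F : fan V} (L : sheaf F).

Context {m : nat} (s : 'I_m -> int).

Let K c := dsum_module (L c) s.
Let K_res c t (x : K c) : K t := [ffun j => res t ((x : {ffun 'I_m -> L c}) j)].

Fact dsum_res_add c t (x y : K c) : fan_cones F c -> face t c ->
  K_res t (x + y) = K_res t x + K_res t y.
Proof. by move=> Fc tc; apply/ffunP => j; rewrite !ffunE res_add. Qed.

Fact dsum_res_scale c t a (x : K c) : fan_cones F c -> face t c ->
  K_res t (a *: x) = sym_res (cone_span t) a *: K_res t x.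
Proof. by move=> Fc tc; apply/ffunP => j; rewrite !ffunE res_scale. Qed.

Fact dsum_res_deg c t d (x : K c) : fan_cones F c -> face t c ->
  gm_deg d x -> gm_deg d (K_res t x).
Proof. by move=> Fc tc xd j; rewrite ffunE; apply: res_deg. Qed.

Fact dsum_res_id c (x : K c) : fan_cones F c -> K_res c x = x.
Proof. by move=> Fc; apply/ffunP => j; rewrite !ffunE res_id. Qed.

Fact dsum_res_comp c t u (x : K c) : fan_cones F c -> face t c -> face u t ->
  K_res u (K_res t x) = K_res u x.
Proof. by move=> Fc tc ut; apply/ffunP => j; rewrite !ffunE res_comp. Qed.

Definition dsum_sheaf : sheaf F :=
  Sheaf dsum_res_add dsum_res_scale dsum_res_deg dsum_res_id dsum_res_comp.

Definition dsum_proj c (x : dsum_sheaf c) j : L c := (x : {ffun 'I_m -> L c}) j.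

Lemma dsum_is_section U (y : forall c, dsum_sheaf c) :
  is_section U y <-> forall j, is_section U (fun c => dsum_proj (y c) j).
Proof.
split=> [ys j c t Uc Ut tc|ys c t Uc Ut tc].
  by have /ffunP/(_ j) := ys c t Uc Ut tc; rewrite ffunE.
by apply/ffunP => j; rewrite ffunE; apply: (ys j).
Qed.

Lemma dsum_flabby : flabby L -> flabby dsum_sheaf.
Proof.
move=> flL U y sU /dsum_is_section ys.
have /choice[y' y'P] j : exists y' : forall c, L c,
    is_section F y' /\ forall c, U c -> y' c = dsum_proj (y c) j.
  by have [y' ? ?] := flL U _ sU (ys j); exists y'.
exists (fun c => [ffun j => y' j c] : dsum_sheaf c).
  apply/dsum_is_section => j c t Fc Ft tc.
  by rewrite /dsum_proj !ffunE; apply: (y'P j).1.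
by move=> c Uc; apply/ffunP => j; rewrite ffunE (y'P j).2.
Qed.

Lemma dsum_graded_free c : graded_free (L c) -> graded_free (dsum_sheaf c).
Proof.
move=> /graded_free_hbasis[k [e [d eb]]].
have := hbasis_reindex (@enum_val_bij _) (dsum_hbasis s eb).
exact: hbasis_graded_free.
Qed.

Lemma dsum_proj_sum c (I : finType) (a : I -> {mpoly R[\dim (cone_span c)]})
    (y : I -> dsum_sheaf c) j :
  dsum_proj (\sum_i a i *: y i) j = \sum_i a i *: dsum_proj (y i) j.
Proof. by rewrite /dsum_proj sum_ffunE; apply: eq_bigr => i _; rewrite ffunE. Qed.

Lemma dsum_section_plus U (y : forall c, dsum_sheaf c) : (U `<=` F)%classic ->
  section_plus U y <-> forall j, section_plus U (fun c => dsum_proj (y c) j).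
Proof.
move=> UF; split=> [[k [a [z [a0 zs zE]]]] j|ys].
  exists k, a, (fun i c => dsum_proj (z i c) j); split=> // [i|c Uc].
    exact: (dsum_is_section _ _).1.
  by rewrite zE // dsum_proj_sum.
(* Each summand has its own number of terms; the data are packed into one type for choice, and the
   combined expansion is indexed by the dependent pairs [J]. *)
pose T := {k : nat & (('I_k -> {mpoly R[\dim (fullv : {vspace V})]})
                      * ('I_k -> forall c, L c))%type}.
have /choice[w wP] j : exists w : T,
    [/\ forall i, sym_plus ((projT2 w).1 i),
        forall i, is_section U ((projT2 w).2 i) &
        forall c, U c -> dsum_proj (y c) j =
          \sum_i sym_res (cone_span c) ((projT2 w).1 i) *: (projT2 w).2 i c].
  by have [k [a [z zP]]] := ys j; exists (existT _ k (a, z)).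
pose J := {j : 'I_m & 'I_(projT1 (w j))}.
apply: (@section_plusI _ _ F dsum_sheaf J (fun p => (projT2 (w (tag p))).1 (tagged p))
  (fun p c => dsum_inj s (tag p) ((projT2 (w (tag p))).2 (tagged p) c))).
- by move=> p; have [] := wP (tag p).
- move=> p; have [_ /(_ (tagged p)) ws _] := wP (tag p).
  apply/dsum_is_section => j c t Uc Ut tc; rewrite /dsum_proj !ffunE.
  case: ifP => _; first exact: ws.
  exact: res0 (UF c Uc) tc.
- move=> c Uc; apply/ffunP => j; rewrite -/(dsum_proj (y c) j).
  have [_ _ ->] := wP j; last exact: Uc.
  rewrite -/(dsum_proj (\sum_i _) j) dsum_proj_sum.
  rewrite -(@sig_big_dep _ _ _ _ _ xpredT (fun _ => xpredT) (fun k l =>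
    sym_res (cone_span c) ((projT2 (w k)).1 l) *:
      dsum_proj (dsum_inj s k ((projT2 (w k)).2 l c) : dsum_sheaf c) j)) /=.
  rewrite (bigD1 j) //= [X in _ = _ + X]big1 ?addr0 => [|k kj].
    by apply: eq_bigr => l _; rewrite /dsum_proj ffunE eqxx.
  by rewrite big1 // => l _; rewrite /dsum_proj ffunE eq_sym (negbTE kj) scaler0.
Qed.

(** Surjectivity is checked in each summand. For injectivity, each component has coordinates without
    constant term, and these are assembled in the basis of the direct sum. *)
Lemma dsum_bar_boundary_iso c : fan_cones F c -> graded_free (L c) ->
  bar_boundary_iso L c -> bar_boundary_iso dsum_sheaf c.
Proof.
move=> Fc free [inj surj].
have bF : (boundary c `<=` F)%classic by move=> t [/(fan_face Fc)].
split=> [x /(dsum_section_plus _ bF) xp|y /dsum_is_section ys].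
  have [k [e [d eb]]] := graded_free_hbasis free.
  have /choice[a aP] j : exists a : 'I_k -> {mpoly R[\dim (cone_span c)]},
      (forall i, (a i)@_0%MM = 0) /\ dsum_proj x j = \sum_i a i *: e i.
    have /(stalk_plus_coef eb)[a a0 aE] : stalk_plus (dsum_proj x j).
      apply: inj; have [l [b [z [b0 zs zE]]]] := xp j; exists l, b, z; split=> // t bt.
      by rewrite -zE // /dsum_proj ffunE.
    by exists a.
  rewrite (_ : x = \sum_p a p.1 p.2 *: dsum_inj s p.1 (e p.2)).
    apply: (coef_stalk_plus (M := dsum_sheaf) (a := fun p => a p.1 p.2)) => p.
    exact: (aP p.1).1.
  by apply/ffunP => j; rewrite (dsum_comb s a (fun=> e)) -(aP j).2.
have /choice[x xP] j := surj _ (ys j).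
exists ([ffun j => x j] : dsum_sheaf c); apply/(dsum_section_plus _ bF) => j.
have [l [b [z [b0 zs zE]]]] := xP j; exists l, b, z; split=> // t bt.
by rewrite -zE // /dsum_proj !ffunE.
Qed.

End DirectSumSheaf.

(** * Restriction to a subfan, non-negative degrees and Poincare polynomials *)

Section Assembly.
Local Open Scope ring_scope.
Context {R : realType} {V : vectType R}.

Definition restrict_sheaf (F G : fan V) (GF : (G `<=` F)%classic) (M : sheaf F) : sheaf G :=
  @Sheaf R V G M (@res _ _ _ M)
    (fun c t x y Gc => @res_add _ _ _ M c t x y (GF c Gc))
    (fun c t a x Gc => @res_scale _ _ _ M c t a x (GF c Gc))
    (fun c t d x Gc => @res_deg _ _ _ M c t d x (GF c Gc))
    (fun c x Gc => @res_id _ _ _ M c x (GF c Gc))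
    (fun c t u x Gc => @res_comp _ _ _ M c t u x (GF c Gc)).

Lemma restrict_flabby (F G : fan V) (GF : (G `<=` F)%classic) (M : sheaf F) :
  flabby M -> flabby (restrict_sheaf GF M).
Proof.
move=> flM U y [UG Uf] ys; have [|y' y's y'E] := flM U y _ ys.
  by split=> // c /UG/GF.
by exists y' => // c t /GF Fc /GF Ft; apply: y's.
Qed.

(** A basis element of negative degree restricts to zero on the boundary by induction, so
    injectivity puts it in the positive-degree submodule; but its coefficient on itself is 1. *)
Lemma stalk_deg_ge0 (F : fan V) (M : sheaf F) r :
  (forall c, fan_cones F c -> ~ face r c -> forall x : M c, x = 0) ->
  (forall c, star F r c -> graded_free (M c)) ->
  (forall c, star F r c -> c <> r -> bar_boundary_iso M c) ->
  (forall D (x : M r), gm_deg D x -> D < 0 -> x = 0) ->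
  forall c, star F r c -> forall D (x : M c), gm_deg D x -> D < 0 -> x = 0.
Proof.
move=> M0 free iso Mr c; have [n] := ubnP (\dim (cone_span c)).
elim: n c => // n IH c; rewrite ltnS => cn rc.
have [->//|cr] := pselect (c = r); have [Fc fc] := rc.
have [k [e [d eb]]] := graded_free_hbasis (free c rc).
apply: (hbasis_deg_ge0 eb) => i; rewrite leNgt; apply/negP => di.
have [ed _ _] := eb; have [inj _] := iso c rc cr.
have /(stalk_plus_coef eb)[a a0] : stalk_plus (e i).
  (* The restriction to the boundary is zero, written as the empty sum indexed by [void]. *)
  apply: inj; apply: (@section_plusI _ _ _ _ void (of_void _) (of_void _)) => [[]|[]|t bt].
  rewrite big1 => [|[]]; have Ft : fan_cones F t by apply: fan_face Fc _; case: bt.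
  have [rt|nrt] := pselect (face r t); last exact: M0 nrt _.
  apply: (IH t _ (conj Ft rt)) di.
    by apply: leq_trans cn; case: bt; apply: face_dim_lt.
  by apply: res_deg => //; case: bt.
have -> : e i = \sum_j (j == i)%:R *: e j.
  rewrite (bigD1 i) //= eqxx scale1r big1 ?addr0 // => j /negbTE ->.
  by rewrite scale0r.
move=> /(hbasis_inj eb)/(_ i) ai; have := a0 i; rewrite -ai eqxx mcoeff1 eqxx.
by move=> /eqP; rewrite oner_eq0.
Qed.

(** The absolute value only turns an integer into an exponent; it is faithful when the degrees are
    non-negative. *)
Definition degree_poly (I : finType) (d : I -> int) : {poly nat} := \sum_i 'X^`|d i|.

Lemma coef_degree_poly (I : finType) (d : I -> int) (D : nat) : (forall i, 0 <= d i) ->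
  (degree_poly d)`_D = #|[pred i | d i == D%:Z]|.
Proof.
move=> d0; rewrite coef_sum -sum1_card [RHS]big_mkcond; apply: eq_bigr => i _ /=.
rewrite coefXn inE -[d i in RHS]gez0_abs // eqz_nat eq_sym.
by case: eqP.
Qed.

Lemma degree_polyM (I J : finType) (d : I -> int) (d' : J -> int) :
  (forall i, 0 <= d i) -> (forall j, 0 <= d' j) ->
  degree_poly d * degree_poly d' = degree_poly (fun p => d p.1 + d' p.2).
Proof.
move=> d0 d'0; rewrite /degree_poly big_distrlr pair_bigA; apply: eq_bigr => -[i j] _ /=.
rewrite -exprD; congr ('X^_); apply/eqP; rewrite -eqz_nat PoszD !gez0_abs //.
exact: addr_ge0.
Qed.

Lemma hbasis_bar_poincare (F : fan V) (M : sheaf F) c (I : finType) (e : I -> M c) d :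
  hbasis e d -> (forall i, 0 <= d i) -> bar_poincare M c (degree_poly d).
Proof.
move=> eb d0 [D|D]; first by rewrite coef_degree_poly //; apply: hbasis_bar_dim eb _.
rewrite -[0%N](_ : #|[pred i | d i == Negz D]| = 0%N); first exact: hbasis_bar_dim eb _.
by apply: eq_card0 => i; rewrite !inE; apply/negP => /eqP di; have := d0 i; rewrite di.
Qed.

End Assembly.

Section Minimal.
Local Open Scope ring_scope.
Context {R : realType} {V : vectType R} {F : fan V} {M : sheaf F} {r : cone V}.

Lemma minimal_sheaf_off_star : minimal_sheaf M r ->
  forall c, fan_cones F c -> ~ face r c -> forall x : M c, x = 0.
Proof.
move=> [_ _ _ [_ off] _] c Fc nrc x; apply: contrapT => x0.
by apply: nrc; have [|] := off c Fc; first by exists x.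
Qed.

Lemma minimal_hbasis_ge0 : is_minimal_sheaf_at M r ->
  forall c (I : finType) (e : I -> M c) d, star F r c -> hbasis e d -> forall i, 0 <= d i.
Proof.
move=> [Mmin /poly_module_hbasis[e0 e0b]] c I e d rc eb i.
have M0 := minimal_sheaf_off_star Mmin; have [_ _ free _ iso] := Mmin.
rewrite leNgt; apply/negP => di; apply: (hbasis_neq0 (i := i) eb).
have [ed _ _] := eb; apply: (stalk_deg_ge0 M0 _ iso _ rc (ed i) di) => [t [Ft _]|].
  exact: free.
exact: (hbasis_deg_ge0 e0b).
Qed.

End Minimal.

(** * Comparison of the three Poincare polynomials *)

Theorem theorem8p1 (R : realType) (V : vectType R) (sigma tau : cone V)
    (tau_sigma : face tau sigma)
    (L_sigma : sheaf (cone_fan sigma))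
    (L_tau : sheaf (cone_fan tau))
    (L_star : sheaf (cone_fan sigma))
    (min_sigma : is_minimal_sheaf_at L_sigma origin)
    (min_tau : is_minimal_sheaf_at L_tau origin)
    (min_star : is_minimal_sheaf_at L_star tau) :
  exists ip_sigma ip_tau ip_star : {poly nat},
    [/\ bar_poincare L_sigma sigma ip_sigma,
        bar_poincare L_tau tau ip_tau,
        bar_poincare L_star sigma ip_star &
        forall d : nat, (((ip_tau * ip_star)%R`_d)%R <= (ip_sigma`_d)%R)%N].
Proof.
have Fsigma : fan_cones (cone_fan sigma) sigma by apply: face_refl.
have o_sigma : star (cone_fan sigma) origin sigma by split=> //; apply: origin_face.
have o_tau : star (cone_fan sigma) origin tau by split=> //; apply: origin_face.
have o_tau' : star (cone_fan tau) origin tau by split; [apply: face_refl|apply: origin_face].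
have tau_star : star (cone_fan sigma) tau sigma by [].
have [[_ fl_sigma free_sigma _ _] /poly_module_hbasis[e0 e0b]] := min_sigma.
have [[_ fl_tau free_tau _ iso_tau] /poly_module_hbasis[e0' e0b']] := min_tau.
have [[_ fl_star free_star _ iso_star] /poly_module_hbasis[e1 e1b]] := min_star.
have [k [es [ds esb]]] := graded_free_hbasis (free_sigma _ Fsigma).
have [k' [et [dt etb]]] := graded_free_hbasis (free_tau tau (face_refl tau)).
have [l [er [dr erb]]] := graded_free_hbasis (free_star _ Fsigma).
have [m [eu [du eub]]] := graded_free_hbasis (free_sigma tau tau_sigma).
have ds0 := minimal_hbasis_ge0 min_sigma o_sigma esb.
have dt0 := minimal_hbasis_ge0 min_tau o_tau' etb.
have dr0 := minimal_hbasis_ge0 min_star tau_star erb.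
have du0 := minimal_hbasis_ge0 min_sigma o_tau eub.
exists (degree_poly ds), (degree_poly dt), (degree_poly dr).
split; [exact: hbasis_bar_poincare esb _|exact: hbasis_bar_poincare etb _|
        exact: hbasis_bar_poincare erb _|move=> D].
(* Both [L_tau] and the restriction of [L_sigma] have one generator of degree 0 at the origin, so
   the rank bound applies with base [origin]. *)
have tau_le i : (((degree_poly dt)`_i)%R <= ((degree_poly du)`_i)%R)%N.
  rewrite !coef_degree_poly //.
  have sub : (cone_fan tau `<=` cone_fan sigma)%classic.
    by move=> t tt; apply: face_trans tt tau_sigma.
  apply: (@minimal_rank_le _ _ _ L_tau (restrict_sheaf sub L_sigma) origin _ e0' e0
    (fun=> 0%R)) o_tau' etb eub => //.
  - exact: minimal_sheaf_off_star min_tau.1.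
  - by move=> c [Fc _]; apply: free_tau.
  - by move=> c [Fc _]; apply/free_sigma/sub.
  - exact: restrict_flabby.
apply: (@leq_trans ((degree_poly du * degree_poly dr)%R`_D)%R).
  by rewrite !coefM; apply: leq_sum => i _; apply: leq_mul.
(* The product of [degree_poly du] and [degree_poly dr] counts the generators at [sigma] of the sum
   of copies of [L_star] shifted by [du]. *)
rewrite degree_polyM // !coef_degree_poly => [||p]; last 2 first.
- exact: ds0.
- by apply: addr_ge0.
pose K := dsum_sheaf L_star du.
have Kfree c : star (cone_fan sigma) tau c -> graded_free (K c).
  by move=> [Fc _]; apply/dsum_graded_free/free_star.
apply: (@minimal_rank_le _ _ _ K L_sigma tau _
  (fun p : 'I_m * unit => dsum_inj du p.1 (e1 p.2)) (fun p => eu p.1)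
  (fun p => du p.1 + 0)%R) tau_star (dsum_hbasis du erb) esb => //.
- move=> c Fc nc x; apply/ffunP => j; rewrite ffunE.
  exact: (minimal_sheaf_off_star min_star.1).
- exact: dsum_flabby.
- move=> c [Fc fc] ct; apply: dsum_bar_boundary_iso => //; first exact: free_star.
  exact: iso_star.
- by move=> c [Fc _]; apply: free_sigma.
- exact: dsum_hbasis e1b.
(* The generator of [L_star] at [tau] has degree 0, so the shifted copies match the basis [eu] of
   the stalk of [L_sigma] at [tau]. *)
- have -> : (fun p : 'I_m * unit => (du p.1 + 0)%R) = du \o fst.
    by apply/funext => p; rewrite addr0.
  have fst_bij : bijective (fst : 'I_m * unit -> 'I_m).
    by exists (fun j => (j, tt)) => [[j []]|].
  exact: hbasis_reindex fst_bij eub.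
Qed.
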